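(* Let $k$ be a field and let $S$ be a semigroup of $I$-type. Then, for every cocycle $c:S^2\to k^*$, the twisted semigroup algebra $k_cS$ is a domain. In particular $S$ is cancellative.
   Context: Semigroups have a unit. Let $\mathcal{U}$ be the free commutative multiplicative semigroup (with unit) generated by $u_1,\ldots,u_n$. A semigroup $S$ generated by $X=\{x_1,\ldots,x_n\}$ is of (left) $I$-type if there is a bijection $v:\mathcal{U}\to S$ such that $v(1)=1$ and, for all $a\in\mathcal{U}$, $\{v(u_1a),\ldots,v(u_na)\}=\{x_1v(a),\ldots,x_nv(a)\}$. For a ($2$-)cocycle $c:S^2\to k^*$, i.e. $c(x,y)c(xy,z)=c(y,z)c(x,yz)$, the twisted semigroup algebra $k_cS$ is the $k$-algebra with basis $S$ and multiplication $x\cdot y=c(x,y)\,xy$ for $x,y\in S$. Cancellative means both left and right cancellative. *)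

(* Defs.v *)
From HB Require Import structures.
From mathcomp Require Import all_boot all_algebra.
From mathcomp Require Import finmap.
From mathcomp Require Import monalg.

Set Implicit Arguments.
Unset Strict Implicit.
Unset Printing Implicit Defensive.

Import GRing.Theory.

Local Open Scope ring_scope.

(* "Semigroups with unit" are [monoidType]s, whose law is [*%g]. *)

Section IType.
Variables (S : monoidType) (n : nat) (x : 'I_n -> S).

Definition generated_by : Prop :=
  forall s : S, exists w : seq 'I_n, s = (\prod_(i <- w) x i)%g.

(* [{cmonom 'I_n}] is the free commutative monoid on the [ucm i], with law
   [mmul] and unit [mone]; [=i] compares finite lists as sets. *)
Definition I_structure (v : {cmonom 'I_n} -> S) : Prop :=
  [/\ bijective v,
      v mone = 1%g
    & forall a : {cmonom 'I_n},
        [seq v (mmul (ucm i) a) | i : 'I_n] =i [seq (x i * v a)%g | i : 'I_n]].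

End IType.

Definition I_type (S : monoidType) : Prop :=
  exists (n : nat) (x : 'I_n -> S),
    generated_by x /\ exists v : {cmonom 'I_n} -> S, I_structure x v.

Definition cancellative (S : monoidType) : Prop :=
  @right_injective S S S *%g /\ @left_injective S S S *%g.

(* [nzRingType] already requires [1 != 0], and no commutativity. *)
Definition is_domain (R : nzRingType) : Prop :=
  forall f g : R, f * g = 0 -> f = 0 \/ g = 0.

(* No normalization [c 1 1 = 1] is imposed. *)
Record cocycle (k : fieldType) (S : monoidType) := Cocycle {
  cocycle_fun :> S -> S -> k;
  cocycle_neq0 : forall s t, cocycle_fun s t != 0;
  cocycleE : forall s t u,
    cocycle_fun s t * cocycle_fun (s * t)%g u =
    cocycle_fun t u * cocycle_fun s (t * u)%g
}.

Definition twisted (k : fieldType) (S : monoidType) (c : cocycle k S) : Type :=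
  {malg k[S]}.

Section Twisted.
Variables (k : fieldType) (S : monoidType) (c : cocycle k S).

Local Notation A := (twisted c).

HB.instance Definition _ := GRing.Lmodule.copy A {malg k[S]}.

Implicit Types f g h : {malg k[S]}.

Definition twmul f g : {malg k[S]} :=
  \sum_(s <- msupp f) \sum_(t <- msupp g)
     mkmalgU (s * t)%g (f@_s * g@_t * c s t).

(* As [c] need not be normalized, the unit is [(c 1 1)^-1 *: 1]. *)
Definition twone : {malg k[S]} := mkmalgU 1%g (c 1%g 1%g)^-1.

Local Notation term f g s t := (mkmalgU (s * t)%g (f@_s * g@_t * c s t)).

Lemma twmulw (d1 d2 : {fset S}) f g :
    (msupp f `<=` d1)%fset -> (msupp g `<=` d2)%fset ->
  twmul f g = \sum_(s <- d1) \sum_(t <- d2) term f g s t.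
Proof.
move=> le1 le2; rewrite /twmul (big_fset_incl _ le1) /=.
  apply: eq_bigr => s _; apply: big_fset_incl => // t _ /mcoeff_outdom ->.
  by rewrite mulr0 mul0r monalgU0.
move=> s _ /mcoeff_outdom fs.
by rewrite big1 // => t _; rewrite fs !mul0r monalgU0.
Qed.

Lemma twmulDl : left_distributive twmul +%R.
Proof.
move=> f g h; pose d := (msupp f `|` msupp g)%fset.
rewrite (@twmulw d (msupp h)) ?msuppD_le ?fsubset_refl //.
rewrite (@twmulw d (msupp h) f) ?fsubsetUl ?fsubset_refl //.
rewrite (@twmulw d (msupp h) g) ?fsubsetUr ?fsubset_refl //.
rewrite -big_split /=; apply: eq_bigr => s _.
rewrite -big_split /=; apply: eq_bigr => t _.
by rewrite mcoeffD !mulrDl monalgUD.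
Qed.

Lemma twmulDr : right_distributive twmul +%R.
Proof.
move=> h f g; pose d := (msupp f `|` msupp g)%fset.
rewrite (@twmulw (msupp h) d) ?msuppD_le ?fsubset_refl //.
rewrite (@twmulw (msupp h) d _ f) ?fsubsetUl ?fsubset_refl //.
rewrite (@twmulw (msupp h) d _ g) ?fsubsetUr ?fsubset_refl //.
rewrite -big_split /=; apply: eq_bigr => s _.
rewrite -big_split /=; apply: eq_bigr => t _.
by rewrite mcoeffD mulrDr mulrDl monalgUD.
Qed.

Lemma twmul0l f : twmul 0 f = 0.
Proof. by rewrite /twmul msupp0 big_seq_fset0. Qed.

Lemma twmul0r f : twmul f 0 = 0.
Proof. by rewrite /twmul msupp0 big1 // => s _; rewrite big_seq_fset0. Qed.

Lemma twmulUU a b s t :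
  twmul (mkmalgU s a) (mkmalgU t b) = mkmalgU (s * t)%g (a * b * c s t).
Proof. by rewrite (twmulw msuppU_le msuppU_le) !big_seq_fset1 !mcoeffUU. Qed.

Lemma twmul_suml I (r : seq I) (F : I -> {malg k[S]}) g :
  twmul (\sum_(i <- r) F i) g = \sum_(i <- r) twmul (F i) g.
Proof.
exact: (big_morph (twmul^~ g) (fun _ _ => twmulDl _ _ _) (twmul0l g)).
Qed.

Lemma twmul_sumr I (r : seq I) (F : I -> {malg k[S]}) g :
  twmul g (\sum_(i <- r) F i) = \sum_(i <- r) twmul g (F i).
Proof. exact: (big_morph (twmul g) (fun _ _ => twmulDr _ _ _) (twmul0r g)). Qed.

Lemma cocycle1l s : c 1%g s = c 1%g 1%g.
Proof.
have := cocycleE c 1%g 1%g s; rewrite !Monoid.mul1m.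
by move/(mulIf (cocycle_neq0 c _ _)).
Qed.

Lemma cocycle1r s : c s 1%g = c 1%g 1%g.
Proof.
have := cocycleE c s 1%g 1%g; rewrite !Monoid.mulm1.
by move/(mulIf (cocycle_neq0 c _ _)).
Qed.

Lemma twmul1l : left_id twone twmul.
Proof.
move=> f; rewrite [f]monalgE twmul_sumr; apply: eq_bigr => s _.
by rewrite twmulUU cocycle1l mulrAC mulVf ?cocycle_neq0 // mul1r Monoid.mul1m.
Qed.

Lemma twmul1r : right_id twone twmul.
Proof.
move=> f; rewrite [f]monalgE twmul_suml; apply: eq_bigr => s _.
by rewrite twmulUU cocycle1r mulfVK ?cocycle_neq0 // Monoid.mulm1.
Qed.

Lemma twmulA : associative twmul.
Proof.
move=> f g h; rewrite [f]monalgE !twmul_suml; apply: eq_bigr => s _.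
rewrite [g]monalgE twmul_sumr !twmul_suml twmul_sumr; apply: eq_bigr => t _.
rewrite [h]monalgE !twmul_sumr; apply: eq_bigr => u _.
rewrite !twmulUU Monoid.mulmA; congr mkmalgU.
transitivity (f@_s * g@_t * h@_u * (c t u * c s (t * u)%g)).
  by rewrite !mulrA.
by rewrite -cocycleE !mulrA; congr (_ * _); rewrite mulrAC.
Qed.

Lemma twone_neq0 : twone != 0.
Proof. by rewrite monalgU_eq0 invr_eq0 cocycle_neq0. Qed.

HB.instance Definition _ :=
  GRing.Zmodule_isNzRing.Build A twmulA twmul1l twmul1r twmulDl twmulDr twone_neq0.

Lemma scaleUE a b (s : S) : a *: mkmalgU s b = mkmalgU s (a * b) :> {malg k[S]}.
Proof. by apply/malgP=> t; rewrite mcoeffZ !mcoeffU mulrnAr. Qed.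

Lemma twmulZl (a : k) f g : twmul (a *: f) g = a *: twmul f g.
Proof.
rewrite [f]monalgE scaler_sumr !twmul_suml scaler_sumr.
apply: eq_bigr => s _; rewrite [g]monalgE !twmul_sumr scaler_sumr.
by apply: eq_bigr => t _; rewrite scaleUE !twmulUU scaleUE !mulrA.
Qed.

Lemma twmulZr (a : k) f g : twmul f (a *: g) = a *: twmul f g.
Proof.
rewrite [f]monalgE !twmul_suml scaler_sumr.
apply: eq_bigr => s _; rewrite [g]monalgE scaler_sumr !twmul_sumr scaler_sumr.
apply: eq_bigr => t _.
by rewrite scaleUE !twmulUU scaleUE (mulrCA _ a) !mulrA.
Qed.

Lemma twscaleAl (a : k) (f g : A) : a *: (f * g) = (a *: f) * g.
Proof. by rewrite [RHS]twmulZl. Qed.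

HB.instance Definition _ := GRing.Lmodule_isLalgebra.Build k A twscaleAl.

Lemma twscaleAr (a : k) (f g : A) : a *: (f * g) = f * (a *: g).
Proof. by rewrite [RHS]twmulZr. Qed.

HB.instance Definition _ := GRing.Lalgebra_isAlgebra.Build k A twscaleAr.

Definition twbasis (s : S) : A := mkmalgU s 1.

Lemma twbasisM s t : twbasis s * twbasis t = c s t *: twbasis (s * t)%g.
Proof. by rewrite [LHS]twmulUU [RHS]scaleUE !mul1r mulr1. Qed.

Lemma twbasisE (f : A) : f = \sum_(s <- msupp f) mcoeff s f *: twbasis s.
Proof.
by rewrite {1}[f]monalgE; apply: eq_bigr => s _; rewrite [RHS]scaleUE mulr1.
Qed.

End Twisted.

(* Main.v *)
Require Import Defs.
From HB Require Import structures.
From mathcomp Require Import all_boot all_order all_fingroup all_algebra finmap.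
From mathcomp Require Import mpoly.
From mathcomp Require Import monalg.
From mathcomp Require Import ring zify.
From Stdlib Require Import Classical ClassicalEpsilon.

Set Implicit Arguments.
Unset Strict Implicit.
Unset Printing Implicit Defensive.

Import GRing.Theory Num.Theory.
Local Open Scope ring_scope.

(** Write exponent vectors additively. Right multiplication by [t], read through
    the bijection [v], maps the edges leaving each exponent vector bijectively
    to edges leaving its image, and it respects the squares formed by two
    edges; unique factorization then forces it to be a permutation of the
    coordinates followed by a translation. So [S] is the set of exponent vectors
    with the product [a * b = pact (twist b) a + b] ([I_type_coordinates]), and
    cancellation follows. Some [m > 0] makes all multiples of [m] untwisted
    ([untwisted_multiples]); left multiplication by these multiples acts on [S]
    by free translations, with finitely many orbit types.

    The twisted algebra [A] is graded by the degree, so a zero divisor would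
    give nonzero homogeneous [f], [g] with [f * g = 0]. Let [h1] and [h2] be the
    Hilbert functions of the left annihilator of [g] and of the left ideal
    [A g], the latter shifted by the degree of [g]. By rank-nullity they add up
    to the Hilbert function of [A], which is that of a polynomial ring in [n]
    variables. Both ideals are nonzero, and the untwisted multiples move any
    nonzero element to linearly independent ones ([lattice_orbit_free]), so both
    [h1] and [h2] grow at the full polynomial rate. Hence both have a positive
    multiplicity (leading coefficient relative to [A]), and the two
    multiplicities add up to 1.

    The contradiction is that the multiplicities are integers. The trivial right
    module has a finite resolution by finitely generated graded free right
    [A]-modules ([flag_resolution]). Tensored with [M = A g] it becomes a complex
    that is exact in all large degrees: [A] is graded left noetherian because of
    the untwisted multiples ([graded_submodule_fg]), and the exactness in large
    degrees passes from the syzygies of a module to the module itself, one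
    homological degree later ([eventually_exact]). With [chi] the Euler
    polynomial of the resolution, [chi * h_M] is therefore a polynomial, while
    [chi * h_A = 1]. So [h_M = p * h_A] for an integral polynomial [p], whose
    value at 1 is the multiplicity of [M].

    The resolution is the chain complex of the orthant of exponent vectors,
    where a cell is a vector [a] with a simplex supported on the coordinates
    that are nonzero in [a]. The simplices are the flags of the barycentric
    subdivision, because a permutation of the coordinates maps flags to flags
    without introducing signs. *)

(** * Coordinates on a semigroup of I-type *)

Local Notation mdeg := mpoly.mdeg.

Lemma functional_choice (T U : Type) (P : T -> U -> Prop) :
  (forall x, exists y, P x y) -> exists f : T -> U, forall x, P x (f x).
Proof.
move=> h; exists (fun x => sval (constructive_indefinite_description _ (h x))) => x.
by case: constructive_indefinite_description.
Qed.
Arguments functional_choice {T U} P _.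

Definition pact n (s : 'S_n) (m : multinom n) : multinom n :=
  [multinom m (s i) | i < n].

Section PermAction.
Variable n : nat.
Implicit Types (s t : 'S_n) (a b : multinom n).

Lemma pactD s a b : pact s (a + b)%MM = (pact s a + pact s b)%MM.
Proof. by apply/mnmP => i; rewrite !(mnmE, mnmDE). Qed.

Lemma pact0 s : pact s 0%MM = 0%MM.
Proof. by apply/mnmP => i; rewrite !(mnmE, mnm0E). Qed.

Lemma pact_id a : pact 1%g a = a.
Proof. by apply/mnmP => i; rewrite !mnmE perm1. Qed.

Lemma pactM s t a : pact (s * t)%g a = pact s (pact t a).
Proof. by apply/mnmP => i; rewrite !mnmE permM. Qed.

Lemma pactK s : cancel (pact s) (pact s^-1%g).
Proof. by move=> a; rewrite -pactM mulVg pact_id. Qed.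

Lemma pactVK s : cancel (pact s^-1%g) (pact s).
Proof. by move=> a; rewrite -pactM mulgV pact_id. Qed.

Lemma pactU s i : pact s U_(i)%MM = U_(s^-1%g i)%MM.
Proof.
by apply/mnmP => j; rewrite !mnmE -[in RHS](inj_eq (@perm_inj _ s)) permKV.
Qed.

Lemma pactMn s a k : pact s (a *+ k)%MM = (pact s a *+ k)%MM.
Proof. by apply/mnmP => i; rewrite !(mnmE, mulmnE). Qed.

Lemma pact_faithful s t : (forall a, pact s a = pact t a) -> s = t.
Proof.
move=> st; apply/permP => i; move: (st U_(s i)%MM) => /mnmP/(_ i).
by rewrite !mnmE eqxx; case: eqP.
Qed.

Lemma mdeg_pact s a : mdeg (pact s a) = mdeg a.
Proof.
by rewrite !mpoly.mdegE [RHS](reindex_inj (@perm_inj _ s)); apply: eq_bigr => i _;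
   rewrite mnmE.
Qed.

End PermAction.

(** [S] as a set of exponent vectors on which right multiplication acts by
    affine maps; [expo] is a 1-cocycle for the action of [S] through [twist]. *)
Record coordinates (S : monoidType) (n : nat) := Coordinates {
  expo : S -> multinom n;
  elt : multinom n -> S;
  twist : S -> 'S_n;
  expoK : cancel expo elt;
  eltK : cancel elt expo;
  expoM : forall s t, expo (s * t)%g = (pact (twist t) (expo s) + expo t)%MM
}.

Lemma multinom_ind n (P : multinom n -> Prop) :
  P 0%MM -> (forall i a, P a -> P (U_(i) + a)%MM) -> forall a, P a.
Proof.
move=> P0 PU a; elim: {a}(mdeg a) {-2}a (erefl (mdeg a)) => [|d IH] a.
  by move/eqP; rewrite mpoly.mdeg_eq0 => /eqP->.
move=> da; have [i ai] : exists i, a i != 0%N.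
  apply: NNPP => h; have: a = 0%MM.
    apply/mnmP => i; rewrite mnm0E; apply: NNPP => ai; apply: h.
    by exists i; apply/eqP.
  by move=> a0; rewrite a0 mpoly.mdeg0 in da.
have le : (U_(i) <= a)%MM by rewrite lep1mP.
rewrite -(submK le) addmC; apply: PU; apply: IH.
by move: da; rewrite -{1}(submK le) mpoly.mdegD mpoly.mdeg1 addn1 => -[].
Qed.

Section CoordinatesOfIType.
Variables (S : monoidType) (n : nat) (x : 'I_n -> S).
Variable w : multinom n -> S.
Variable e : S -> multinom n.
Hypotheses (eK : cancel e w) (wK : cancel w e) (w0 : w 0%MM = 1%g).
Hypothesis xw : forall a,
  [seq w (U_(i) + a)%MM | i : 'I_n] =i [seq (x i * w a)%g | i : 'I_n].

(** The defining property of an I-structure at [w (e s)]: left multiplication by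
    the generators enumerates the vectors [U_(j) + e s], each once. *)
Lemma left_step_perm s :
  exists p : 'S_n, forall i, e (x i * s)%g = (U_(p i) + e s)%MM.
Proof.
have h i : exists j, e (x i * s)%g = (U_(j) + e s)%MM.
  have: (x i * w (e s))%g \in [seq (x i * w (e s))%g | i : 'I_n].
    by apply: map_f; rewrite mem_enum.
  by rewrite -xw => /mapP[j _]; rewrite eK => ->; exists j; rewrite wK.
pose p i := sval (constructive_indefinite_description _ (h i)).
have pE i : e (x i * s)%g = (U_(p i) + e s)%MM.
  by rewrite /p; case: constructive_indefinite_description.
have p_surj j : exists i, p i = j.
  have: w (U_(j) + e s)%MM \in [seq w (U_(i) + e s)%MM | i : 'I_n].
    exact: (map_f (fun i => w (U_(i) + e s)%MM) (mem_enum 'I_n j)).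
  rewrite xw => /mapP[i _]; rewrite eK => /(congr1 e); rewrite wK pE.
  by move/addIm/eqP; rewrite eq_mnm1 => /eqP ->; exists i.
have p_inj : injective p.
  pose q j := sval (constructive_indefinite_description _ (p_surj j)).
  have qK : cancel q p.
    by move=> j; rewrite /q; case: constructive_indefinite_description.
  have q_inj := can_inj qK.
  have [r rq rK] : bijective q by apply: injF_bij.
  by move=> i j; rewrite -[i]rK -[j]rK !qK => ->.
by exists (perm p_inj) => i; rewrite permE.
Qed.

Let lp s := sval (constructive_indefinite_description _ (left_step_perm s)).
Let lpE s i : e (x i * s)%g = (U_(lp s i) + e s)%MM.
Proof. by rewrite /lp; case: constructive_indefinite_description. Qed.

(** Right multiplication by [t] sends the edge from [b] in direction [j] to the
    edge from its image in direction [rot b t j]. *)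
Let rot b t := ((lp (w b))^-1 * lp (w b * t)%g)%g.

Let rotE b t j :
  e (w (U_(j) + b)%MM * t)%g = (U_(rot b t j) + e (w b * t)%g)%MM.
Proof.
have -> : w (U_(j) + b)%MM = (x ((lp (w b))^-1 j) * w b)%g.
  by apply: (can_inj eK); rewrite lpE !wK permKV.
by rewrite -mulgA lpE permM.
Qed.

(** For [l != j] the square spanned at [b] by [l] and [j] goes to a square whose
    two edges at the image of [b] point in distinct directions, so opposite
    sides of the image square have the same direction. A permutation known
    off [j] is known at [j] too. *)
Let rot_step b t j : rot (U_(j) + b)%MM t = rot b t.
Proof.
have off l : l != j -> rot (U_(j) + b)%MM t l = rot b t l.
  move=> lj; have: e (w (U_(l) + (U_(j) + b))%MM * t)%g =
                 e (w (U_(j) + (U_(l) + b))%MM * t)%g.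
    by congr (e (w _ * t)%g); rewrite !addmA [X in (X + b)%MM]addmC.
  rewrite !rotE !addmA => /addIm /mnmP/(_ (rot b t l)).
  rewrite !mnmDE !mnm1E eqxx [rot b t j == _](inj_eq (@perm_inj _ _)).
  rewrite (eq_sym j) (negbTE lj) addn0 addn1.
  by case: eqP => // ->.
apply/permP => l; case: (eqVneq l j) => [->|]; last exact: off.
pose k := (rot (U_(j) + b)%MM t)^-1%g (rot b t j).
have kE : rot (U_(j) + b)%MM t k = rot b t j by rewrite permKV.
case: (eqVneq k j) => [kj|kj]; first by rewrite -kE kj.
by move: (off k kj); rewrite kE => /perm_inj jk; rewrite -jk eqxx in kj.
Qed.

Let rot_const b t : rot b t = rot 0%MM t.
Proof. by elim/multinom_ind: b => // i b <-; exact: rot_step. Qed.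

(** The direction map [rot b t] does not change along edges, hence not at all,
    and right multiplication by [t] is the affine map with linear part
    [rot 0 t] and translation part [e t]. *)
Lemma coordinates_of_I_structure : inhabited (coordinates S n).
Proof.
constructor; apply: (@Coordinates S n e w (fun t => (rot 0%MM t)^-1%g) eK wK).
move=> s t; rewrite -{1}(eK s).
elim/multinom_ind: {s}(e s) => [|i b IH].
  by rewrite w0 mul1g pact0 add0m.
by rewrite rotE IH rot_const pactD pactU invgK addmA.
Qed.

End CoordinatesOfIType.

Lemma I_type_coordinates (S : monoidType) :
  I_type S -> exists n, inhabited (coordinates S n).
Proof.
case=> n [x [_ [v [v_bij v1 vx]]]]; exists n.
have [e eK vK] := v_bij.
pose c2m (a : {cmonom 'I_n}) : multinom n := [multinom a i | i < n].
pose m2c (m : multinom n) : {cmonom 'I_n} :=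
  mkcmonom [fsfun i in [fset i | i in 'I_n]%fset => m i | 0%N].
have m2cE m i : m2c m i = m i.
  by rewrite cmE fsfun_fun !inE.
have c2mK : cancel c2m m2c.
  by move=> a; apply/eqP/cmP => i; rewrite m2cE mnmE.
have m2cK : cancel m2c c2m.
  by move=> m; apply/mnmP => i; rewrite mnmE m2cE.
have m2cD a b : m2c (a + b)%MM = mmul (m2c a) (m2c b).
  by apply/eqP/cmP => i; rewrite cmM !m2cE mnmDE.
have m2cU i : m2c U_(i)%MM = ucm i.
  by apply/eqP/cmP => j; rewrite cmU m2cE mnm1E.
have m2c0 : m2c 0%MM = mone.
  by apply/eqP/cmP => j; rewrite cm1 m2cE mnm0E.
apply: (@coordinates_of_I_structure S n x (v \o m2c) (c2m \o e)).
- exact: can_comp.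
- exact: can_comp.
- by rewrite /= m2c0.
move=> a s; rewrite /= -vx; congr (s \in _); apply: eq_map => i /=.
by rewrite m2cD m2cU.
Qed.


Section Coordinates.
Variables (S : monoidType) (n : nat) (C : coordinates S n).
Local Notation expo := (expo C).
Local Notation elt := (elt C).
Local Notation twist := (twist C).
Let expoK : cancel expo elt := expoK C.
Let eltK : cancel elt expo := eltK C.

Lemma expo1 : expo 1%g = 0%MM.
Proof.
have := expoM C 1%g 1%g; rewrite mulg1 -{1}[expo 1%g]add0m => /addIm h.
by rewrite -(pactK (twist 1%g) (expo 1%g)) -h pact0.
Qed.

Lemma twistM s t : twist (s * t)%g = (twist t * twist s)%g.
Proof.
apply: pact_faithful => a; rewrite pactM.
have := congr1 expo (mulgA (elt a) s t).
by rewrite !expoM pactD addmA eltK => /addIm /addIm.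
Qed.

Lemma twist1 : twist 1%g = 1%g.
Proof. by apply: (mulgI (twist 1%g)); rewrite -twistM !mulg1. Qed.

Lemma twistX s k : twist (s ^+ k)%g = (twist s ^+ k)%g.
Proof. by elim: k => [|k IH]; [exact: twist1|rewrite expgS expgSr twistM IH]. Qed.

Lemma coordinates_cancellative : cancellative S.
Proof.
split=> [s t u st | s t u ts].
  have tw : twist t = twist u.
    by apply: (mulIg (twist s)); rewrite -!twistM /= st.
  have := congr1 expo st; rewrite !expoM tw => /addmI.
  by move/(can_inj expoK).
have := congr1 expo ts; rewrite !expoM => /addIm.
by move/(can_inj (pactK _))/(can_inj expoK).
Qed.

Definition weight s := mdeg (expo s).

Lemma weightM s t : weight (s * t)%g = (weight s + weight t)%N.
Proof. by rewrite /weight expoM mpoly.mdegD mdeg_pact. Qed.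

(** The untwisted vectors act on the right by plain translations; they form an
    additive monoid. *)
Let untwisted a := twist (elt a) = 1%g.

Let twist_eltD a b :
  twist (elt (pact (twist (elt a)) b + a)%MM) =
  (twist (elt a) * twist (elt b))%g.
Proof.
by rewrite -twistM; congr twist; apply: (can_inj expoK); rewrite expoM !eltK.
Qed.

Let twist_untwistedD a b :
  untwisted a -> twist (elt (b + a)%MM) = twist (elt b).
Proof. by move=> Ha; have := twist_eltD a b; rewrite Ha pact_id mul1g. Qed.

(** In a group the conjugate of [a] by [s] would be the vector
    [pact (twist s) a]. Powers of [s] replace the inverse: with [N] the order of
    the twist of [s], the element [s ^ (N - 1) * a * s] is untwisted and is
    the translate of [pact (twist s) a] by the untwisted vector of [s ^ N]. *)
Lemma untwisted_pact s a : untwisted a -> untwisted (pact (twist s) a).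
Proof.
move=> Ha; set p := twist s.
have N0 : (0 < #[p]%g)%N by exact: order_gt0.
have H0 : untwisted (expo (s ^+ #[p]%g)%g).
  by rewrite /untwisted expoK twistX expg_order.
pose w := (s ^+ #[p]%g.-1 * elt a * s)%g.
have tw : twist w = 1%g.
  by rewrite /w !twistM twistX Ha mul1g -expgS prednK // expg_order.
have ew : expo w = (pact p a + expo (s ^+ #[p]%g)%g)%MM.
  rewrite /w !expoM Ha pact_id eltK pactD -{2}(prednK N0) expgSr expoM.
  by rewrite addmA [X in (X + _)%MM]addmC.
by rewrite /untwisted -(twist_untwistedD _ H0) -ew expoK.
Qed.

(** Two multiples [U_(i) *+ j] and [U_(i) *+ j'] have the same twist, so a
    permuted copy of their difference is untwisted; [untwisted_pact] undoes the
    permutation. *)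
Lemma untwisted_variable i : exists2 l, (0 < l)%N & untwisted (U_(i) *+ l)%MM.
Proof.
pose f (j : 'I_(#|{: 'S_n}|).+1) := twist (elt (U_(i) *+ j)%MM).
have [j [j' [jj' fjj']]] : exists j j' : 'I_#|{: 'S_n}|.+1, (j < j')%N /\ f j = f j'.
  apply: NNPP => h; have f_inj : injective f.
    move=> j j' fjj'; apply: val_inj => /=; case: (ltngtP j j') => // jj'.
      by case: h; exists j, j'.
    by case: h; exists j', j.
  by have := leq_card f f_inj; rewrite card_ord ltnn.
exists (j' - j)%N; first by rewrite subn_gt0.
pose a := (U_(i) *+ j)%MM; pose b := pact (twist (elt a))^-1%g (U_(i) *+ (j' - j))%MM.
suff Hb : untwisted b.
  by rewrite -(pactVK (twist (elt a)) (_ *+ _)%MM); apply: untwisted_pact.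
apply: (mulgI (twist (elt a))); rewrite -twist_eltD pactVK mulg1.
rewrite -[RHS]/(f j) fjj' /f; congr (twist (elt _)).
by apply/mnmP => k; rewrite mnmDE !mulmnE -mulnDr subnK // ltnW.
Qed.

Lemma untwisted_multiples :
  exists2 m, (0 < m)%N & forall a, twist (elt (a *+ m)%MM) = 1%g.
Proof.
have [l lP] : exists l : 'I_n -> nat,
    forall i, (0 < l i)%N /\ untwisted (U_(i) *+ l i)%MM.
  apply: (functional_choice (fun i l => (0 < l)%N /\ untwisted (U_(i) *+ l)%MM)).
  by move=> i; have [l l0 lH] := untwisted_variable i; exists l.
have lkH i k : untwisted (U_(i) *+ (l i * k))%MM.
  elim: k => [|k IH]; first by rewrite muln0 mulm0n -expo1 /untwisted expoK twist1.
  have -> : (U_(i) *+ (l i * k.+1) = U_(i) *+ (l i * k) + U_(i) *+ l i)%MM.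
    by apply/mnmP => j; rewrite mnmDE !mulmnE mulnS mulnDr addnC.
  by rewrite /untwisted twist_untwistedD //; case: (lP i).
exists (\prod_i l i)%N; first by apply: prodn_gt0 => i; case: (lP i).
elim/multinom_ind => [|i a IH].
  have -> : (0 *+ \prod_i l i = expo 1%g)%MM.
    by rewrite expo1; apply/mnmP => j; rewrite mulmnE mnm0E.
  by rewrite expoK twist1.
have -> : ((U_(i) + a) *+ \prod_i l i = a *+ \prod_i l i + U_(i) *+ \prod_i l i)%MM.
  by apply/mnmP => j; rewrite mnmDE !mulmnE mnmDE mulnDl addnC.
by rewrite twist_untwistedD // /untwisted (bigD1 i) //=; apply: lkH.
Qed.

End Coordinates.

(** * Coefficients in a twisted semigroup algebra *)

Section TwistedAlgebra.
Variables (k : fieldType) (S : monoidType) (c : cocycle k S).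
Local Notation A := (twisted c).
Implicit Types (f g h : A) (s t u : S) (p q : pred S).

Definition twcoef s f : k := mcoeff s f.

Lemma twcoefP f g : (forall s, twcoef s f = twcoef s g) -> f = g.
Proof. by move=> fg; apply/malgP. Qed.

Lemma twcoef_is_linear s : linear (twcoef s : A -> k^o).
Proof.
by move=> a f g; rewrite /twcoef [LHS]mcoeffD; congr (_ + _); exact: mcoeffZ.
Qed.
HB.instance Definition _ s :=
  GRing.isLinear.Build k A k^o _ (twcoef s) (twcoef_is_linear s).

Lemma twcoef0 s : twcoef s 0 = 0.
Proof. exact: mcoeff0. Qed.

Lemma twcoefB s f g : twcoef s (f - g) = twcoef s f - twcoef s g.
Proof. exact: mcoeffB. Qed.

Lemma twcoefD s f g : twcoef s (f + g) = twcoef s f + twcoef s g.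
Proof. exact: mcoeffD. Qed.

Lemma twcoefZ s a f : twcoef s (a *: f) = a * twcoef s f.
Proof. by rewrite linearZ. Qed.

Lemma twcoef_basis s t : twcoef s (twbasis c t) = (t == s)%:R.
Proof. by rewrite /twcoef mcoeffU; case: eqP. Qed.

Lemma twcoef_supp s f : twcoef s f != 0 -> s \in msupp f.
Proof. by rewrite mcoeff_neq0. Qed.

Lemma twisted_neq0 f : f <> 0 -> exists s, twcoef s f != 0.
Proof.
move=> f0; apply: NNPP => h; apply: f0; apply: twcoefP => s; rewrite raddf0.
by apply/eqP; apply: NNPP => /negP fs; apply: h; exists s.
Qed.

Lemma twcoef_basisM s t f :
  right_injective (@mulg S) ->
  twcoef (s * t)%g (twbasis c s * f) = c s t * twcoef t f.
Proof.
move=> inj; rewrite {1}[f]twbasisE mulr_sumr raddf_sum /=.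
rewrite (eq_bigr (fun u => twcoef u f * c s u * (u == t)%:R)); last first.
  move=> u _; rewrite -scalerAr twbasisM !twcoefZ twcoef_basis mulrA.
  by rewrite (inj_eq (inj s)).
case: (msuppP f t) => [tf|ntf].
  rewrite (big_fsetD1 t) //= eqxx mulr1 big_seq big1 ?addr0 1?mulrC //.
  by move=> u; rewrite !inE => /andP[/negbTE -> _]; rewrite mulr0.
rewrite /twcoef (mcoeff_outdom ntf) mulr0 big_seq big1 // => u uf.
by case: eqP => [ut|]; rewrite ?mulr0 // -ut uf in ntf *.
Qed.

Lemma twcoef_mul_neq0 u f g : twcoef u (f * g) != 0 ->
  exists s t, [/\ u = (s * t)%g, twcoef s f != 0 & twcoef t g != 0].
Proof.
move=> h; apply: NNPP => nh; case/negP: h; apply/eqP.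
rewrite [f]twbasisE [g]twbasisE mulr_suml raddf_sum /=.
rewrite big_seq big1 // => s sf; rewrite mulr_sumr raddf_sum /=.
rewrite big_seq big1 // => t tg; rewrite -scalerAr -scalerAl twbasisM !twcoefZ.
rewrite twcoef_basis; case: eqP => [stu|_]; last by rewrite !mulr0.
by case: nh; exists s, t; split; rewrite // mcoeff_neq0.
Qed.

Lemma twisted_mulE f g : f * g = \sum_(s <- msupp f) \sum_(t <- msupp g)
  (twcoef s f * twcoef t g * c s t) *: twbasis c (s * t)%g.
Proof.
refine (eq_bigr _ _) => s _; refine (eq_bigr _ _) => t _.
by rewrite [RHS]scaleUE mulr1.
Qed.

(** The component of [f] on the basis elements selected by [p]; it serves to
    extract the homogeneous parts. *)
Definition restrict (p : pred S) f : A :=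
  \sum_(s <- msupp f | p s) twcoef s f *: twbasis c s.

Lemma twcoef_restrict p s f : twcoef s (restrict p f) = if p s then twcoef s f else 0.
Proof.
rewrite /restrict raddf_sum /= (eq_bigr (fun t => twcoef t f * (t == s)%:R)).
  case: (msuppP f s) => [sf|nsf]; last first.
    rewrite /twcoef (mcoeff_outdom nsf) if_same big_seq_cond big1 // => t.
    case/andP=> tf _; case: eqP => [ts|]; rewrite ?mulr0 //.
    by rewrite -ts tf in nsf.
  rewrite big_mkcond (big_fsetD1 s) //= eqxx mulr1 big_seq big1 ?addr0 //.
  by move=> t; rewrite !inE => /andP[/negbTE-> _]; rewrite mulr0 if_same.
by move=> t _; rewrite twcoefZ twcoef_basis.
Qed.

Lemma restrict_is_linear p : linear (restrict p).
Proof.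
move=> a f g; apply: twcoefP => s; rewrite linearP /= !twcoef_restrict linearP.
by case: (p s) => //; rewrite scaler0 addr0.
Qed.
HB.instance Definition _ p :=
  GRing.isLinear.Build k A A _ (restrict p) (restrict_is_linear p).

Lemma restrict_id p f : (forall s, twcoef s f != 0 -> p s) -> restrict p f = f.
Proof.
move=> h; apply: twcoefP => s; rewrite twcoef_restrict; case: ifP => // ps.
by apply/esym/eqP; apply: NNPP => /negP/h; rewrite ps.
Qed.

Lemma restrict_basis p s :
  restrict p (twbasis c s) = if p s then twbasis c s else 0.
Proof.
apply: twcoefP => t; rewrite twcoef_restrict twcoef_basis.
case: ifP => pt; case: ifP => ps; rewrite ?twcoef_basis ?raddf0 //;
by case: eqP => // st; move: pt ps; rewrite st => ->.
Qed.

Lemma restrict_mulr p q f g :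
    (forall s t, twcoef t g != 0 -> p s = q (s * t)%g) ->
  restrict q (f * g) = restrict p f * g.
Proof.
move=> pq; rewrite [f]twbasisE mulr_suml raddf_sum raddf_sum mulr_suml /=.
refine (eq_bigr _ _) => s _; rewrite -scalerAl !linearZ /= -scalerAl; congr (_ *: _).
rewrite {1 2}[g]twbasisE !mulr_sumr raddf_sum /= big_seq [RHS]big_seq.
refine (eq_bigr _ _) => t tg; rewrite -!scalerAr linearZ /= twbasisM linearZ /=.
rewrite !restrict_basis -pq ?mcoeff_neq0 //; case: (p s).
  by rewrite twbasisM.
by rewrite mul0r scaler0.
Qed.

Lemma restrict_mull p q f g :
    (forall s t, twcoef s f != 0 -> p t = q (s * t)%g) ->
  restrict q (f * g) = f * restrict p g.
Proof.
move=> pq; rewrite [f]twbasisE mulr_suml raddf_sum [RHS]mulr_suml /= big_seq [RHS]big_seq.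
refine (eq_bigr _ _) => s sf; rewrite -!scalerAl !linearZ /=; congr (_ *: _).
rewrite {1 2}[g]twbasisE mulr_sumr raddf_sum raddf_sum mulr_sumr /=.
refine (eq_bigr _ _) => t tg; rewrite -!scalerAr !linearZ /= -!scalerAr twbasisM.
rewrite !linearZ /= !restrict_basis -pq ?mcoeff_neq0 //; case: (p t).
  by rewrite twbasisM !scalerA mulrC.
by rewrite mulr0 !scaler0.
Qed.

End TwistedAlgebra.

(** * Dickson's lemma *)

Section Dickson.

Lemma tail_argmin (f : nat -> nat) N :
  exists2 i, (N <= i)%N & forall j, (N <= j)%N -> (f i <= f j)%N.
Proof.
suff h v : forall i, (N <= i)%N -> (f i <= v)%N ->
    exists2 i, (N <= i)%N & forall j, (N <= j)%N -> (f i <= f j)%N.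
  exact: (h (f N) N).
elim: v => [|v IH] i Ni fi.
  by exists i => // j _; move: fi; rewrite leqn0 => /eqP ->.
case: (classic (exists2 j, (N <= j)%N & (f j < f i)%N)) => [[j Nj fj]|nh].
  by apply: (IH j Nj); rewrite -ltnS (leq_trans fj).
exists i => // j Nj; rewrite leqNgt; apply/negP => fj; apply: nh.
by exists j.
Qed.

Definition strictly_increasing (g : nat -> nat) := forall i, (g i < g i.+1)%N.

Lemma strictly_increasing_le g i j :
  strictly_increasing g -> (i <= j)%N -> (g i <= g j)%N.
Proof.
move=> hg; elim: j => [|j IH]; first by rewrite leqn0 => /eqP ->.
rewrite leq_eqVlt => /predU1P[->//|/IH h].
exact: leq_trans h (ltnW (hg j)).
Qed.

Lemma strictly_increasing_lt g i j :
  strictly_increasing g -> (i < j)%N -> (g i < g j)%N.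
Proof. by move=> hg ij; apply: leq_trans (hg i) (strictly_increasing_le hg ij). Qed.

(** Take a minimum of the whole sequence, then a minimum of what comes after it,
    and so on. *)
Lemma nondecreasing_subsequence (f : nat -> nat) :
  exists2 g, strictly_increasing g &
    forall i j, (i <= j)%N -> (f (g i) <= f (g j))%N.
Proof.
have [h hP] : exists h : nat -> nat, forall N,
    (N <= h N)%N /\ forall j, (N <= j)%N -> (f (h N) <= f j)%N.
  apply: (functional_choice (fun N i =>
    (N <= i)%N /\ forall j, (N <= j)%N -> (f i <= f j)%N)) => N.
  by have [i Ni fi] := tail_argmin f N; exists i.
pose g := fix g i := if i is j.+1 then h (g j).+1 else h 0%N.
have hg : strictly_increasing g by move=> i /=; case: (hP (g i).+1).
exists g => // i j ij; have: (g i <= g j)%N by apply: strictly_increasing_le.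
case: i {ij} => [|i] gij; first by case: (hP 0%N) => _; apply.
by case: (hP (g i).+1) => _; apply; apply: leq_trans (hg i) _.
Qed.

Lemma nondecreasing_subsequences p (f : nat -> nat -> nat) :
  exists2 g, strictly_increasing g & forall c, (c < p)%N ->
    forall i j, (i <= j)%N -> (f c (g i) <= f c (g j))%N.
Proof.
elim: p => [|p [g hg gP]]; first by exists id.
have [g' hg' g'P] := nondecreasing_subsequence (f p \o g).
exists (g \o g') => [i|c]; first exact: strictly_increasing_lt hg (hg' i).
rewrite ltnS leq_eqVlt => /predU1P[->|cp] i j ij; first exact: g'P.
by apply: gP => //; apply: strictly_increasing_le.
Qed.

Lemma dickson n q (f : nat -> multinom n * 'I_q) :
  exists i j, [/\ (i < j)%N, ((f i).1 <= (f j).1)%MM & (f i).2 = (f j).2].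
Proof.
(* Both the index and its complement are added as coordinates: if neither
   decreases, the index is constant. *)
pose h c i := if insub c is Some c' then (f i).1 c'
              else if c == n then val (f i).2 else (q - (f i).2)%N.
have [g hg gP] := nondecreasing_subsequences n.+2 h.
exists (g 0%N), (g 1%N); split=> //.
  apply/mnm_lepP => c; have := gP c _ 0%N 1%N isT.
  by rewrite /h valK; apply; rewrite ltnS ltnW // ltnS ltnW.
apply: val_inj; apply/eqP; rewrite eqn_leq; apply/andP; split.
  by have := gP n _ 0%N 1%N isT; rewrite /h insubF ?ltnn // eqxx; apply.
have := gP n.+1 (ltnSn _) 0%N 1%N isT.
rewrite /h insubF ?ltnNge ?leqnSn // gtn_eqF //.
by rewrite leq_sub2lE // ltnW.
Qed.

Lemma dickson_basis n q (Q : multinom n * 'I_q -> Prop) :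
  exists2 l : seq (multinom n * 'I_q), (forall a, a \in l -> Q a) &
    forall a, Q a -> exists2 b, b \in l & (b.1 <= a.1)%MM /\ b.2 = a.2.
Proof.
apply: NNPP => nh.
pose bad (l : seq (multinom n * 'I_q)) a := Q a /\ forall b, b \in l -> ~ ((b.1 <= a.1)%MM /\ b.2 = a.2).
have hbad (l : seq (multinom n * 'I_q)) :
    exists a, (forall b, b \in l -> Q b) -> bad l a.
  case: (classic (forall b, b \in l -> Q b)) => lQ; last first.
    by apply: NNPP => na; case: (lQ) => b bl; case: na; exists b => /lQ.
  apply: NNPP => h; apply: nh; exists l => // a Qa; apply: NNPP => na; apply: h.
  by exists a => _; split=> // b bl ba; apply: na; exists b.
have [g gP] := functional_choice _ hbad.
pose s := fix s i := if i is j.+1 then rcons (s j) (g (s j)) else [::].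
have sQ i b : b \in s i -> Q b.
  elim: i b => // i IH b; rewrite mem_rcons inE => /predU1P[->|/IH//].
  by case: (gP (s i) IH).
have s_mem i j : (i < j)%N -> g (s i) \in s j.
  elim: j => // j IH; rewrite ltnS leq_eqVlt mem_rcons inE => /predU1P[->|/IH->].
    by rewrite eqxx.
  by rewrite orbT.
have [i [j [ij le_ij eq_ij]]] := dickson (g \o s).
have [_ /(_ _ (s_mem _ _ ij))] := gP (s j) (sQ j).
by apply.
Qed.

End Dickson.

Lemma seq_argmax d (O : orderType d) (T : eqType) (f : T -> O) (r : seq T) x0 :
  x0 \in r -> exists2 x, x \in r & forall y, y \in r -> (f y <= f x)%O.
Proof.
elim: r x0 => // a r IH x0 _; case: r IH => [|b r] IH.
  by exists a; rewrite ?inE // => y; rewrite inE => /eqP ->.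
have [x xr xP] := IH b (mem_head _ _).
have /orP[ax|xa] := Order.le_total (f a) (f x).
  exists x; first by rewrite in_cons xr orbT.
  by move=> y; rewrite in_cons => /predU1P[->|/xP].
exists a; first exact: mem_head.
move=> y; rewrite in_cons => /predU1P[->//|/xP h].
exact: Order.le_trans h xa.
Qed.

(** * Graded left submodules of free modules are finitely generated *)

Lemma lexi_wf n q : well_founded (fun u v : multinom n *l 'I_q => (u < v)%O).
Proof.
case=> a i; elim/(well_founded_ind (@ltom_wf n)): a i => a IHa.
suff h N : forall i : 'I_q, (i < N)%N ->
    Acc (fun u v : multinom n *l 'I_q => (u < v)%O) (a, i).
  by move=> i; apply: (h i.+1).
elim: N => [i|N IHi i iN]; first by rewrite ltn0.
constructor=> -[b j]; rewrite Order.ProdLexiOrder.ltEprodlexi /=.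
rewrite Order.POrderTheory.le_eqVlt; case/andP => /orP[/eqP->|ba _]; last exact: IHa.
by rewrite Order.POrderTheory.lexx /= => ji; apply: IHi; exact: leq_trans ji _.
Qed.

Section Lattice.
Variables (S : monoidType) (n : nat) (C : coordinates S n) (m : nat).
Hypotheses (m_gt0 : (0 < m)%N)
           (untwisted : forall a, twist C (elt C (a *+ m)%MM) = 1%g).
Implicit Types (s t u : S) (a : multinom n).

(** Elements of [S] on which the twist is trivial and which therefore translate
    [S] freely. *)
Definition lattice a : S := elt C (a *+ m)%MM.

(** [quo] and [res] are coordinates on [S] in which left multiplication by
    [lattice a] translates [quo] by [a] and fixes [res]. The permutation in
    [quo] compensates for the twist that [s] imposes on what stands on its
    left. *)
Definition quo s : multinom n :=
  pact (twist C s)^-1%g [multinom expo C s i %/ m | i < n]%N.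

Definition res s : {ffun 'I_n -> 'I_m} :=
  [ffun i => Ordinal (ltn_pmod (expo C s i) m_gt0)].

Let expo_latticeM a s :
  expo C (lattice a * s)%g = (pact (twist C s) a *+ m + expo C s)%MM.
Proof. by rewrite expoM eltK pactMn. Qed.

Let twist_latticeM a s : twist C (lattice a * s)%g = twist C s.
Proof. by rewrite twistM /lattice untwisted mulg1. Qed.

Lemma quo_latticeM a s : quo (lattice a * s)%g = (a + quo s)%MM.
Proof.
rewrite /quo twist_latticeM -{2}[a](pactK (twist C s)) -pactD; congr pact.
by apply/mnmP => i; rewrite mnmDE !mnmE expo_latticeM mnmDE mulmnE divnMDl ?mnmE.
Qed.

Lemma res_latticeM a s : res (lattice a * s)%g = res s.
Proof.
apply/ffunP => i; rewrite !ffunE; apply: val_inj => /=.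
by rewrite expo_latticeM mnmDE mulmnE modnMDl.
Qed.

(** [s] differs from the element with exponents [res s] by left multiplication
    with a lattice element, so both have the same twist, and [quo] can be
    undone. *)
Lemma quo_res_inj s t : quo s = quo t -> res s = res t -> s = t.
Proof.
pose r s := elt C [multinom (res s i : nat) | i < n].
suff dec u : u = (lattice (quo u) * r u)%g.
  by move=> qst rst; rewrite (dec s) (dec t) qst /r rst.
pose b := [multinom expo C u i %/ m | i < n]%N.
have uE : u = (lattice (pact (twist C (r u))^-1%g b) * r u)%g.
  apply: (can_inj (expoK C)); rewrite expo_latticeM pactVK; apply/mnmP => i.
  by rewrite mnmDE mulmnE /r eltK !mnmE ffunE -divn_eq.
have tu : twist C u = twist C (r u) by rewrite {1}uE twist_latticeM.
by rewrite {1}uE /quo tu.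
Qed.

Lemma weight_lattice a : weight C (lattice a) = (mdeg a * m)%N.
Proof. by rewrite /weight eltK mpoly.mdegMn. Qed.

Variables (k : fieldType) (c : cocycle k S).
Local Notation A := (twisted c).

Lemma twcoef_latticeM a s (f : A) :
  twcoef (lattice a * s)%g (twbasis c (lattice a) * f) =
  c (lattice a) s * twcoef s f.
Proof. exact: twcoef_basisM (coordinates_cancellative C).1. Qed.

Lemma twcoef_latticeM_neq0 u a (f : A) :
  twcoef u (twbasis c (lattice a) * f) != 0 ->
  exists2 s, u = (lattice a * s)%g & twcoef s f != 0.
Proof.
move/twcoef_mul_neq0 => [s [t [-> sf tf]]]; exists t => //.
by move: sf; rewrite twcoef_basis; case: (lattice a =P s) => [->|_]; rewrite ?eqxx.
Qed.

Section Noetherian.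
Variables (r : nat) (shift : 'I_r -> nat).
Implicit Types (y z : 'rV[A]_r) (x : S * 'I_r).

Let q := #|{: {ffun 'I_n -> 'I_m} * 'I_r}|.

(** Monomial order for a Groebner basis argument over the lattice: the quotient
    comes first, the finitely many orbit types break ties. *)
Let key x : multinom n *l 'I_q := (quo x.1, enum_rank (res x.1, x.2)).

Let translate a x : S * 'I_r := ((lattice a * x.1)%g, x.2).

Let key_inj : injective key.
Proof.
move=> [s i] [t j] e; have qst : quo s = quo t := congr1 fst e.
by have /enum_rank_inj [rst ->] := congr1 snd e; rewrite (quo_res_inj qst rst).
Qed.

Let le_key_translate a x x' :
  (key x' <= key x)%O -> (key (translate a x') <= key (translate a x))%O.
Proof.
rewrite !Order.ProdLexiOrder.leEprodlexi /= !quo_latticeM !res_latticeM.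
by rewrite !lemc_add2r.
Qed.

Let support y x := twcoef x.1 (y 0 x.2) != 0.

Let lead y x := support y x /\ forall x', support y x' -> (key x' <= key x)%O.

Let lead_exists y : y != 0 -> exists x, lead y x.
Proof.
move=> y0; pose l := [seq (s, b) | b <- enum 'I_r, s <- msupp (y 0 b)].
have lP x : support y x -> x \in l.
  move=> yx; apply/allpairsPdep; exists x.2, x.1.
  by rewrite mem_enum -mcoeff_neq0; split => //; case: (x).
have [x0 yx0] : exists x, support y x.
  apply: NNPP => h; case/eqP: y0; apply/rowP => b; rewrite mxE.
  apply: NNPP => /(@twisted_neq0 _ _ c)[s ys]; apply: h; by exists (s, b).
have x0s : x0 \in [seq x <- l | support y x] by rewrite mem_filter yx0 lP.
have [x] := seq_argmax key x0s; rewrite mem_filter => /andP[yx _] xmax.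
by exists x; split => // x' yx'; apply: xmax; rewrite mem_filter yx' lP.
Qed.

Let lead_translate a y x : lead y x -> lead (twbasis c (lattice a) *: y) (translate a x).
Proof.
case=> yx xmax; split.
  by rewrite /support /= mxE twcoef_latticeM mulf_neq0 ?cocycle_neq0.
move=> [u b]; rewrite /support mxE => /twcoef_latticeM_neq0[s /= -> ys].
exact: (le_key_translate a (xmax (s, b) ys)).
Qed.

Let lt_key_wf : well_founded (fun u v : multinom n *l 'I_q => (u < v)%O) :=
  @lexi_wf n q.

Definition homogeneous_row d y :=
  forall b s, twcoef s (y 0 b) != 0 -> (weight C s + shift b)%N = d.

Variable P : 'rV[A]_r -> Prop.
Hypotheses (PD : forall y z, P y -> P z -> P (y + z))
           (PZ : forall f y, P y -> P (f *: y)).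

(** The keys of leading terms are stable under translation by the lattice, so by
    Dickson's lemma finitely many of them generate all others. Elements of [P]
    with these leading terms generate [P]: subtracting a suitable multiple
    lowers the leading key, and keys are well ordered. *)
Lemma graded_submodule_fg : exists r' (degs : 'I_r' -> nat) (G : 'M[A]_(r', r)),
  (forall j, P (row j G) /\ homogeneous_row (degs j) (row j G)) /\
  forall d y, P y -> homogeneous_row d y -> exists y' : 'rV[A]_r', y = y' *m G.
Proof.
pose Q (u : multinom n * 'I_q) := exists d y x, [/\ P y, homogeneous_row d y, lead y x & key x = u].
have [l lQ Ql] := dickson_basis Q.
have wit (j : 'I_(size l)) : exists p : nat * 'rV[A]_r * (S * 'I_r),
    [/\ P p.1.2, homogeneous_row p.1.1 p.1.2, lead p.1.2 p.2
      & key p.2 = tnth (in_tuple l) j].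
  by have [d [y [x h]]] := lQ _ (mem_tnth j (in_tuple l)); exists (d, y, x).
have {wit} [p pP] := functional_choice _ wit.
pose G := \matrix_j (p j).1.2; exists (size l), (fun j => (p j).1.1), G.
split=> [j|]; first by rewrite rowK; case: (pP j).
move=> d y Py hy; case: (eqVneq y 0) => [->|/lead_exists[x yx]].
  by exists 0; rewrite mul0mx.
move: {2}(key x) (erefl (key x)) => a; elim/(well_founded_ind lt_key_wf): a y x Py hy yx.
move=> a IH y x Py hy yx xa.
have [b bl [ba1 ba2]] : exists2 b, b \in l & (b.1 <= (key x).1)%MM /\ b.2 = (key x).2.
  by apply: Ql; exists d, y, x.
have [j jb] := tnthP (in_tuple l) b bl.
have [Pj hj leadj keyj] := pP j.
set yj := (p j).1.2 in Pj hj leadj; set xj := (p j).2 in leadj keyj.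
pose t := ((key x).1 - b.1)%MM.
have xE : x = translate t xj.
  apply: key_inj; move: ba1 ba2; rewrite /t jb -keyj => le1 e2.
  rewrite [RHS]/key /= quo_latticeM res_latticeM -[quo xj.1]/(key xj).1.
  by rewrite submK // -[enum_rank _]/(key xj).2 e2.
have [sxj _] := leadj.
have [syx ymax] := yx.
pose al := twcoef x.1 (y 0 x.2) / (c (lattice t) xj.1 * twcoef xj.1 (yj 0 xj.2)).
pose f := al *: twbasis c (lattice t); pose z := y - f *: yj.
have zE s i : twcoef s (z 0 i) =
    twcoef s (y 0 i) - al * twcoef s ((twbasis c (lattice t) *: yj) 0 i).
  by rewrite !mxE raddfB /= -scalerAl twcoefZ.
have hz : homogeneous_row d z.
  move=> i s; rewrite zE; case: (eqVneq (twcoef s (y 0 i)) 0) => [->|/hy //].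
  rewrite sub0r oppr_eq0 mulf_eq0 negb_or => /andP[_].
  rewrite mxE => /twcoef_latticeM_neq0[u -> /hj hu].
  have := hy _ _ syx; rewrite xE /= !weightM => <-.
  by rewrite -!addnA hu (hj _ _ sxj).
have Pz : P z by rewrite /z -scaleNr; apply: PD => //; apply: PZ.
have [y' zy'] : exists y' : 'rV[A]_(size l), z = y' *m G.
  case: (eqVneq z 0) => [->|/lead_exists[x' zx']].
    by exists 0; rewrite mul0mx.
  have x'x : (key x' < key x)%O.
    rewrite Order.POrderTheory.lt_neqAle; apply/andP; split.
      apply/eqP => /key_inj x'E; case: zx'; rewrite /support zE x'E.
      rewrite {3 4}xE mxE /= twcoef_latticeM /al mulfVK ?subrr ?eqxx //.
      by rewrite mulf_neq0 // cocycle_neq0.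
    case: zx'; rewrite /support zE => + _.
    case: (eqVneq (twcoef x'.1 (y 0 x'.2)) 0) => [->|/ymax //].
    rewrite sub0r oppr_eq0 mulf_eq0 negb_or => /andP[_] sx'.
    by have [_] := lead_translate t leadj; rewrite -xE; apply.
  by apply: (IH (key x')) zx' (erefl _) => //; rewrite -xa.
exists (y' + f *: delta_mx 0 j); rewrite mulmxDl -zy' /z.
by rewrite -scalemxAl -rowE rowK addrNK.
Qed.

End Noetherian.

End Lattice.

(** * Dimension of subspaces of arbitrary vector spaces *)

Section Dimension.
Variables (k : fieldType).

Definition free_family (V : lmodType k) (I : finType) (b : I -> V) :=
  forall a : I -> k, \sum_j a j *: b j = 0 -> forall j, a j = 0.

Definition spanned_by (V : lmodType k) (I : finType) (b : I -> V) (x : V) :=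
  exists a : I -> k, x = \sum_j a j *: b j.

(** The ambient space need not be finite dimensional, so subspaces are predicates
    and a dimension is witnessed by a basis. *)
Definition has_dim (V : lmodType k) (P : V -> Prop) (r : nat) :=
  exists2 b : 'I_r -> V, free_family b & forall x, P x <-> spanned_by b x.

Record subspace (V : lmodType k) (P : V -> Prop) : Prop := Subspace {
  subspace0 : P 0;
  subspaceP : forall a x y, P x -> P y -> P (a *: x + y)
}.

Section OneSpace.
Variable V : lmodType k.
Implicit Types P : V -> Prop.

Lemma subspaceD P x y : subspace P -> P x -> P y -> P (x + y).
Proof. by move=> sP Px Py; rewrite -[x]scale1r; apply: subspaceP. Qed.

Lemma subspaceZ P a x : subspace P -> P x -> P (a *: x).
Proof.
by move=> sP Px; rewrite -[_ *: _]addr0; apply: subspaceP => //; apply: subspace0.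
Qed.

Lemma subspace_sum P (I : Type) (r : seq I) (p : pred I) (F : I -> V) :
  subspace P -> (forall i, p i -> P (F i)) -> P (\sum_(i <- r | p i) F i).
Proof.
move=> sP PF; elim/big_rec: _ => [|i x pi]; first exact: subspace0.
by apply: subspaceD => //; exact: PF.
Qed.

Lemma subspaceI P1 P2 : subspace P1 -> subspace P2 -> subspace (fun x => P1 x /\ P2 x).
Proof.
move=> s1 s2; split; first by split; apply: subspace0.
by move=> a x y [x1 x2] [y1 y2]; split; apply: subspaceP.
Qed.

Lemma spanned_subspace (I : finType) (b : I -> V) : subspace (spanned_by b).
Proof.
split; first by exists (fun => 0); rewrite big1 // => j _; rewrite scale0r.
move=> a x y [u ->] [v ->]; exists (fun j => a * u j + v j).
rewrite scaler_sumr -big_split /=; apply: eq_bigr => j _.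
by rewrite scalerDl scalerA.
Qed.

Lemma mem_spanned (I : finType) (b : I -> V) j : spanned_by b (b j).
Proof.
exists (fun i => (i == j)%:R); rewrite (bigD1 j) //= eqxx scale1r big1 ?addr0 //.
by move=> i /negbTE ->; rewrite scale0r.
Qed.

Lemma has_dim_fin P (I : finType) (b : I -> V) :
  free_family b -> (forall x, P x <-> spanned_by b x) -> has_dim P #|I|.
Proof.
have re (a : I -> k) :
    \sum_(j < #|I|) a (enum_val j) *: b (enum_val j) = \sum_i a i *: b i.
  by rewrite [RHS](reindex (@enum_val I I)) //; apply: onW_bij; exact: enum_val_bij.
have re' (a : 'I_#|I| -> k) :
    \sum_(j < #|I|) a j *: b (enum_val j) = \sum_i a (enum_rank i) *: b i.
  by rewrite -re; apply: eq_bigr => j _; rewrite enum_valK.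
move=> fb Pb; exists (fun j => b (enum_val j)) => [a|x].
  by rewrite re' => /fb h j; have := h (enum_val j); rewrite enum_valK.
rewrite Pb; split=> -[a ->].
  by exists (fun j => a (enum_val j)); rewrite re.
by exists (fun i => a (enum_rank i)); rewrite re'.
Qed.

Lemma free_family_card P r (I : finType) (b : I -> V) :
  has_dim P r -> free_family b -> (forall j, P (b j)) -> (#|I| <= r)%N.
Proof.
case=> e fe Pe fb bP.
have [M MP] : exists M : 'I_#|I| -> 'rV[k]_r,
    forall i, b (enum_val i) = \sum_j M i 0 j *: e j.
  apply: (functional_choice (fun i (u : 'rV[k]_r) =>
     b (enum_val i) = \sum_j u 0 j *: e j)) => i.
  have /Pe[a ->] := bP (enum_val i); exists (\row_j a j).
  by apply: eq_bigr => j _; rewrite mxE.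
pose N := \matrix_(i < #|I|) M i.
suff /eqP <- : row_free N by exact: rank_leq_col.
rewrite -kermx_eq0; apply/rowV0P => u /sub_kermxP uN.
apply/rowP => i; rewrite mxE -[i]enum_valK.
pose a x := u 0 (enum_rank x); rewrite -[u 0 _]/(a (enum_val i)).
apply: fb; rewrite (reindex (@enum_val I I)) /=; last first.
  by apply: onW_bij; exact: enum_val_bij.
transitivity (\sum_j (u *m N) 0 j *: e j); last first.
  by rewrite uN big1 // => j _; rewrite mxE scale0r.
rewrite (eq_bigr (fun i => \sum_j (u 0 i * M i 0 j) *: e j)).
  rewrite exchange_big /=; apply: eq_bigr => j _; rewrite -scaler_suml mxE.
  by congr (_ *: _); apply: eq_bigr => l _; rewrite mxE.
move=> l _; rewrite /a enum_valK MP scaler_sumr.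
by apply: eq_bigr => j _; rewrite scalerA.
Qed.

Lemma has_dim_unique P r r' : has_dim P r -> has_dim P r' -> r = r'.
Proof.
move=> d d'; apply/eqP; rewrite eqn_leq; apply/andP; split.
  have [b fb Pb] := d; rewrite -[X in (X <= _)%N]card_ord.
  by apply: (free_family_card d' fb) => j; apply/Pb; exact: mem_spanned.
have [b fb Pb] := d'; rewrite -[X in (X <= _)%N]card_ord.
by apply: (free_family_card d fb) => j; apply/Pb; exact: mem_spanned.
Qed.

Definition extend_family s (b : 'I_s -> V) (x : V) (j : 'I_s.+1) :=
  if unlift ord_max j is Some i then b i else x.

Lemma free_family_extend s (b : 'I_s -> V) x :
  free_family b -> ~ spanned_by b x -> free_family (extend_family b x).
Proof.
move=> fb nx a; rewrite big_ord_recr {2}/extend_family unlift_none /= => e.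
pose a' j := a (lift ord_max j).
have e' : \sum_j a' j *: b j + a ord_max *: x = 0.
  rewrite -[RHS]e; congr (_ + _); apply: eq_bigr => j _.
  have -> : widen_ord (leqnSn s) j = lift ord_max j.
    by apply: val_inj; rewrite /= /bump leqNgt ltn_ord.
  by rewrite /extend_family liftK.
have a0 : a ord_max = 0.
  apply/eqP; apply: NNPP => /negP am; apply: nx.
  exists (fun j => - (a ord_max)^-1 * a' j); apply: (scalerI am).
  rewrite scaler_sumr (eq_bigr (fun j => - (a' j *: b j))) => [|j _].
    by rewrite sumrN; apply/eqP; rewrite -addr_eq0 addrC e'.
  by rewrite scalerA mulrA mulrN mulfV // mulN1r scaleNr.
move: e'; rewrite a0 scale0r addr0 => /fb h j.
by case: (unliftP ord_max j) => [i ->|->] //; exact: h.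
Qed.

(** Without a dimension, any free family in [P] could be extended for ever. *)
Lemma has_dim_bounded P r : subspace P ->
  (forall s (b : 'I_s -> V), free_family b -> (forall j, P (b j)) -> (s <= r)%N) ->
  exists r', has_dim P r'.
Proof.
move=> sP bound.
apply: NNPP => nd; suff fam s : exists2 b : 'I_s -> V, free_family b & forall j, P (b j).
  by have [b fb bP] := fam r.+1; have := bound _ _ fb bP; rewrite ltnn.
elim: s => [|s [b fb bP]]; first by exists (fun=> 0) => [a _ []|[]].
have [x [Px nx]] : exists x, P x /\ ~ spanned_by b x.
  apply: NNPP => h; apply: nd; exists s; exists b => // x; split=> [Px|[a ->]].
    by apply: NNPP => nx; apply: h; exists x.
  by apply: subspace_sum => // j _; apply: subspaceZ.
exists (extend_family b x); first exact: free_family_extend.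
by move=> j; rewrite /extend_family; case: unlift.
Qed.

Lemma has_dim_sub P P' r : has_dim P r -> subspace P' -> (forall x, P' x -> P x) ->
  exists r', has_dim P' r'.
Proof.
move=> d sP' P'P; apply: (@has_dim_bounded P' r) => // s b fb bP'.
by rewrite -[s]card_ord; apply: (free_family_card d fb) => j; apply: P'P.
Qed.

Lemma has_dim0 P : (forall x, P x <-> x = 0) -> has_dim P 0.
Proof.
move=> P0; exists (fun=> 0) => [a _ []//|x]; rewrite P0; split=> [->|[a ->]].
  exact: subspace0 (spanned_subspace _).
by rewrite big_ord0.
Qed.

Lemma has_dim_subspace P r : has_dim P r -> subspace P.
Proof.
case=> b _ Pb; split; first by apply/Pb; exact: subspace0 (spanned_subspace _).
move=> a x y /Pb Px /Pb Py; apply/Pb.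
exact: subspaceP (spanned_subspace _) _ _ _ Px Py.
Qed.

End OneSpace.

Section RankNullity.
Variables (V W : lmodType k) (f : {linear V -> W}) (P : V -> Prop) (r : nat).
Hypothesis dimP : has_dim P r.

Definition image_of (y : W) := exists2 x, P x & y = f x.
Definition kernel_in (x : V) := P x /\ f x = 0.

Lemma subspace_image : subspace image_of.
Proof.
have sP := has_dim_subspace dimP.
split; first by exists 0; [exact: subspace0|rewrite linear0].
move=> a _ _ [x Px ->] [y Py ->]; exists (a *: x + y); first exact: subspaceP.
by rewrite linearP.
Qed.

Lemma subspace_kernel : subspace kernel_in.
Proof.
apply: subspaceI; first exact: has_dim_subspace dimP.
by split; [rewrite linear0|move=> a x y fx fy; rewrite linearP /= fx fy scaler0 addr0].
Qed.

(** A basis of the kernel together with preimages of a basis of the image is a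
    basis. *)
Lemma rank_nullity : exists r1 r2,
  [/\ has_dim kernel_in r1, has_dim image_of r2 & r = (r1 + r2)%N].
Proof.
have sP := has_dim_subspace dimP.
have [r1 d1] : exists r1, has_dim kernel_in r1.
  by apply: (has_dim_sub dimP); [exact: subspace_kernel|move=> x []].
have [r2 d2] : exists r2, has_dim image_of r2.
  apply: (@has_dim_bounded _ _ r); first exact: subspace_image.
  move=> s b fb bI.
  have [g gP] : exists g : 'I_s -> V, forall j, P (g j) /\ b j = f (g j).
    apply: (functional_choice (fun j x => P x /\ b j = f x)) => j.
    by have [x] := bI j; exists x.
  rewrite -[s]card_ord; apply: (free_family_card dimP (b := g)); last by move=> j; case: (gP j).
  move=> a /(congr1 f); rewrite linear0 linear_sum => h; apply: fb.
  by rewrite -[RHS]h; apply: eq_bigr => j _; rewrite linearZ; case: (gP j) => _ ->.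
exists r1, r2; split=> //.
have [b1 f1 P1] := d1; have [b2 f2 P2] := d2.
have b1P j : P (b1 j) /\ f (b1 j) = 0 by apply/P1; exact: mem_spanned.
have [g gP] : exists g : 'I_r2 -> V, forall j, P (g j) /\ b2 j = f (g j).
  apply: (functional_choice (fun j x => P x /\ b2 j = f x)) => j.
  by have /P2[x] := mem_spanned b2 j; exists x.
suff: has_dim P #|{: 'I_r1 + 'I_r2}|.
  by rewrite card_sum !card_ord => /(has_dim_unique dimP).
pose b (i : 'I_r1 + 'I_r2) := match i with inl j => b1 j | inr j => g j end.
have sumb (a : 'I_r1 + 'I_r2 -> k) : \sum_i a i *: b i =
    \sum_j a (inl j) *: b1 j + \sum_j a (inr j) *: g j.
  by rewrite big_sumType.
have fsumb (a : 'I_r1 + 'I_r2 -> k) :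
    f (\sum_i a i *: b i) = \sum_j a (inr j) *: b2 j.
  rewrite sumb linearD !linear_sum big1 ?add0r /=; last first.
    by move=> j _; rewrite linearZ /= (b1P j).2 scaler0.
  by apply: eq_bigr => j _; rewrite linearZ /= (gP j).2.
apply: (@has_dim_fin _ _ _ b) => [a ab|x].
  have a2 : forall j, a (inr j) = 0 by apply: f2; rewrite -fsumb ab linear0.
  have a1 : forall j, a (inl j) = 0.
    apply: f1; move: ab; rewrite sumb [X in _ + X]big1 ?addr0 // => j _.
    by rewrite a2 scale0r.
  by case.
split=> [Px|[a ->]]; last first.
  apply: subspace_sum => // -[] j _; apply: subspaceZ => //=.
    by case: (b1P j).
  by case: (gP j).
have /P2[a2 fx] : image_of (f x) by exists x.
have /P1[a1 e1] : kernel_in (x - \sum_j a2 j *: g j).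
  split; last first.
    rewrite linearB /= fx linear_sum; apply/eqP; rewrite subr_eq0; apply/eqP.
    by apply: eq_bigr => j _; rewrite linearZ /= (gP j).2.
  rewrite addrC -sumrN; apply: subspaceD => //.
  apply: subspace_sum => // j _; rewrite -scaleNr; apply: subspaceZ => //.
  by case: (gP j).
exists (fun i => match i with inl j => a1 j | inr j => a2 j end).
by rewrite sumb -e1 subrK.
Qed.

End RankNullity.

Lemma has_dim_ext (V : lmodType k) (P Q : V -> Prop) r :
  (forall x, P x <-> Q x) -> has_dim P r -> has_dim Q r.
Proof. by move=> PQ [b fb Pb]; exists b => // x; rewrite -PQ. Qed.

Lemma has_dim_ffun (V : lmodType k) (I : finType) (P : I -> V -> Prop) (r : I -> nat) :
  (forall i, has_dim (P i) (r i)) ->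
  has_dim (fun z : {ffun I -> V} => forall i, P i (z i)) (\sum_i r i)%N.
Proof.
move=> dP.
have [b bP] : exists b : forall i, 'I_(r i) -> V, forall i,
    free_family (b i) /\ forall x, P i x <-> spanned_by (b i) x.
  have h i : exists b : 'I_(r i) -> V,
      free_family b /\ forall x, P i x <-> spanned_by b x.
    by have [b fb Pb] := dP i; exists b.
  exists (fun i => sval (constructive_indefinite_description _ (h i))) => i.
  by case: constructive_indefinite_description.
pose T := {i : I & 'I_(r i)}.
have <- : #|{: T}| = (\sum_i r i)%N.
  by rewrite card_tagged sumnE big_map big_enum; apply: eq_bigr => i _; rewrite card_ord.
pose e (t : T) : {ffun I -> V} :=
  [ffun i => if tag t == i then b _ (tagged t) else 0].
have eE (a : T -> k) i :
    (\sum_t a t *: e t) i = \sum_j a (Tagged (fun i => 'I_(r i)) j) *: b i j.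
  pose F i' (j : 'I_(r i')) :=
    a (Tagged (fun i => 'I_(r i)) j) *: (if i' == i then b i' j else 0).
  rewrite sum_ffunE (eq_bigr (fun t : T => F (tag t) (tagged t))); last first.
    by move=> [i' j] _; rewrite !ffunE.
  rewrite -(sig_big_dep predT (fun=> predT) F) (bigD1 i) //=.
  rewrite [X in _ + X]big1 ?addr0 => [|i' /negbTE i'i].
    by apply: eq_bigr => j _; rewrite /F eqxx.
  by rewrite big1 // => j _; rewrite /F i'i scaler0.
apply: (@has_dim_fin _ _ _ e) => [a ea [i j]|z].
  by apply: (proj1 (bP i) (fun j => a (Tagged (fun i => 'I_(r i)) j))); rewrite -eE ea ffunE.
split=> [zP|[a ->] i]; last first.
  by rewrite eE; apply/(proj2 (bP i)); exists (fun j => a (Tagged _ j)).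
have [u uP] : exists u : forall i, 'I_(r i) -> k, forall i, z i = \sum_j u i j *: b i j.
  have h i : exists u : 'I_(r i) -> k, z i = \sum_j u j *: b i j.
    exact/(proj2 (bP i)).
  exists (fun i => sval (constructive_indefinite_description _ (h i))) => i.
  by case: constructive_indefinite_description.
by exists (fun t => u _ (tagged t)); apply/ffunP => i; rewrite eE uP.
Qed.

(** With [h i] the dimension of [D (Q i)], exactness says
    [q i = h i.+1 + h i], so the alternating sum telescopes. *)
Lemma exact_complex_euler (V : lmodType k) (D : {linear V -> V})
    (Q : nat -> V -> Prop) (q : nat -> nat) (L : nat) :
  (forall i, has_dim (Q i) (q i)) -> (forall x, Q L x -> x = 0) ->
  (forall x, Q 0%N x -> D x = 0) ->
  (forall i x, Q i.+1 x -> Q i (D x)) ->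
  (forall x, D (D x) = 0) ->
  (forall i x, Q i x -> D x = 0 -> exists2 y, Q i.+1 y & x = D y) ->
  \sum_(i < L) (-1) ^+ i * (q i)%:Z = 0.
Proof.
move=> dQ QL DQ0 DQ DD exQ.
have [h hP] : exists h : nat -> nat, forall i, has_dim (image_of D (Q i)) (h i).
  apply: (functional_choice (fun i => has_dim (image_of D (Q i)))) => i.
  by have [_ [r2 [_ d _]]] := rank_nullity D (dQ i); exists r2.
have qE i : q i = (h i.+1 + h i)%N.
  have [r1 [r2 [d1 d2 ->]]] := rank_nullity D (dQ i).
  rewrite (has_dim_unique d2 (hP i)); congr addn.
  apply: has_dim_unique (hP i.+1); apply: has_dim_ext d1 => x; split.
    by case=> Qx Dx; have [y Qy ->] := exQ _ _ Qx Dx; exists y.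
  by case=> y Qy ->; split; [exact: DQ|exact: DD].
have h0 : h 0%N = 0%N.
  apply: has_dim_unique (hP 0%N) _; apply: has_dim0 => y; split.
    by case=> x /DQ0 + ->.
  by move=> ->; exact: subspace0 (subspace_image D (dQ _)).
have hL : h L = 0%N.
  apply: has_dim_unique (hP L) _; apply: has_dim0 => y; split.
    by case=> x /QL -> ->; rewrite linear0.
  by move=> ->; exact: subspace0 (subspace_image D (dQ _)).
suff tel M : \sum_(i < M) (-1) ^+ i * (q i)%:Z = - ((-1) ^+ M * (h M)%:Z).
  by rewrite tel hL mulr0 oppr0.
elim: M => [|M IH]; first by rewrite big_ord0 h0 mulr0 oppr0.
rewrite big_ord_recr /= IH qE PoszD exprS; ring.
Qed.

End Dimension.

(** * The flag complex as a complex of right modules *)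

Section LinearExtension.
Variables (k : fieldType) (X : choiceType) (V : lmodType k).

Definition lext (g : X -> V) (z : {malg k[X]}) : V :=
  \sum_(x <- msupp z) mcoeff x z *: g x.

Lemma lextEw (g : X -> V) (z : {malg k[X]}) (d : {fset X}) :
  (msupp z `<=` d)%fset -> lext g z = \sum_(x <- d) mcoeff x z *: g x.
Proof.
move=> zd; rewrite /lext; apply: big_fset_incl => // x _ /mcoeff_outdom ->.
by rewrite scale0r.
Qed.

Lemma lext_is_linear g : linear (lext g).
Proof.
move=> a y z; pose d := (msupp y `|` msupp z)%fset.
rewrite (@lextEw _ (a *: y + z) d); last first.
  by apply: fsubset_trans (msuppD_le _ _) _; apply: fsetSU; exact: msuppZ_le.
rewrite (@lextEw _ y d) ?fsubsetUl // (@lextEw _ z d) ?fsubsetUr //.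
rewrite scaler_sumr -big_split /=; apply: eq_bigr => x _.
by rewrite mcoeffD mcoeffZ scalerDl scalerA.
Qed.
HB.instance Definition _ g :=
  GRing.isLinear.Build k {malg k[X]} V _ (lext g) (lext_is_linear g).

Lemma lextU g x : lext g (mkmalgU x 1) = g x.
Proof.
by rewrite (@lextEw _ _ [fset x]%fset) ?msuppU_le // big_seq_fset1 mcoeffUU scale1r.
Qed.

Lemma malg_sum_cells (z : {malg k[X]}) :
  z = \sum_(x <- msupp z) mcoeff x z *: mkmalgU x 1.
Proof.
rewrite {1}[z]monalgE; apply: eq_bigr => x _.
by apply/malgP => y; rewrite mcoeffZ !mcoeffU mulrnAr mulr1.
Qed.

Lemma linear_malg_eq (f g : {linear {malg k[X]} -> V}) (z : {malg k[X]}) :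
  (forall x, x \in msupp z -> f (mkmalgU x 1) = g (mkmalgU x 1)) -> f z = g z.
Proof.
move=> fg; rewrite [z]malg_sum_cells !linear_sum big_seq [RHS]big_seq.
by apply: eq_bigr => x xz; rewrite !linearZ /= fg.
Qed.

End LinearExtension.

Lemma lext_supp (k : fieldType) (X Y : choiceType) (g : X -> {malg k[Y]})
    (w : {malg k[X]}) p :
  mcoeff p (lext g w) != 0 -> exists2 q, mcoeff q w != 0 & mcoeff p (g q) != 0.
Proof.
move=> h; apply: NNPP => nh; case/negP: h; apply/eqP.
rewrite /lext raddf_sum big_seq big1 //= => q qw.
rewrite mcoeffZ; apply/eqP; rewrite mulf_eq0; apply/orP; right.
by apply: NNPP => /negP pq; apply: nh; exists q => //; rewrite mcoeff_neq0.
Qed.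

Section Flags.
Variables (k : fieldType) (S : monoidType) (n : nat) (C : coordinates S n).
Variable c : cocycle k S.
Local Notation A := (twisted c).
Local Notation T := {set 'I_n}.
Local Notation G := {malg k[(S * seq {set 'I_n})%type]}.
Implicit Types (s t : S) (I J : T) (l : seq T) (z : G).

Definition top l : T := head set0 l.

Fixpoint is_flag l :=
  if l is J :: l' then (top l' \proper J) && is_flag l' else true.

(** The face of the orthant in which the exponent vector of [s] lies. *)
Definition supp_set s : T := [set i | expo C s i != 0%N].

Definition indicator I : multinom n := [multinom (i \in I : nat) | i < n].

(** The effect on sets of coordinates of right multiplication by [s]. *)
Definition move_set s I : T := twist C s @^-1: I.

Definition cell s l : G := mkmalgU (s, l) 1.

Definition cons_cell I : G -> G := lext (fun p => cell p.1 (I :: p.2)).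
HB.instance Definition _ I := GRing.Linear.on (cons_cell I).

Fixpoint boundary_cell s l : G :=
  if l is J :: l' then cell s l' - cons_cell J (boundary_cell s l') else 0.

(** The augmented simplicial boundary, for the ordered list [l] of vertices of the
    simplex; the element [s] stays fixed. *)
Definition boundary : G -> G := lext (fun p => boundary_cell p.1 p.2).
HB.instance Definition _ := GRing.Linear.on boundary.

(** Right multiplication by a basis element: [s] multiplies in the twisted
    algebra, the flag is only permuted. *)
Definition shift_cell s : G -> G :=
  lext (fun p => c p.1 s *: cell (p.1 * s)%g (map (move_set s) p.2)).
HB.instance Definition _ s := GRing.Linear.on (shift_cell s).

Definition ract z (f : A) : G := lext (fun s => shift_cell s z) f.

Lemma cons_cellE I s l : cons_cell I (cell s l) = cell s (I :: l).
Proof. exact: lextU. Qed.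

Lemma boundaryE s l : boundary (cell s l) = boundary_cell s l.
Proof. exact: lextU. Qed.

Lemma shift_cellE s t l :
  shift_cell s (cell t l) = c t s *: cell (t * s)%g (map (move_set s) l).
Proof. exact: lextU. Qed.

Lemma boundary_cons I z : boundary (cons_cell I z) = z - cons_cell I (boundary z).
Proof.
apply: (@linear_malg_eq _ _ _ (boundary \o cons_cell I : {linear G -> G})
          (idfun \- (cons_cell I \o boundary) : {linear G -> G})) => -[s l] _.
by rewrite /= -/(cell s l) cons_cellE !boundaryE.
Qed.

Lemma boundary_boundary z : boundary (boundary z) = 0.
Proof.
rewrite -[RHS]/((\0 : {linear G -> G}) z).
apply: (@linear_malg_eq _ _ _ (boundary \o boundary : {linear G -> G}) \0) => -[s l] _.
rewrite /= -/(cell s l) boundaryE; elim: l => [|J l IH] /=; first exact: linear0.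
by rewrite linearB /= boundary_cons boundaryE IH linear0 subr0 subrr.
Qed.

Lemma shift_cell_cons s I z :
  shift_cell s (cons_cell I z) = cons_cell (move_set s I) (shift_cell s z).
Proof.
apply: (@linear_malg_eq _ _ _ (shift_cell s \o cons_cell I : {linear G -> G})
          (cons_cell (move_set s I) \o shift_cell s : {linear G -> G})) => -[t l] _.
by rewrite /= -/(cell t l) cons_cellE !shift_cellE linearZ /= cons_cellE.
Qed.

Lemma boundary_shift s z : boundary (shift_cell s z) = shift_cell s (boundary z).
Proof.
apply: (@linear_malg_eq _ _ _ (boundary \o shift_cell s : {linear G -> G})
          (shift_cell s \o boundary : {linear G -> G})) => -[t l] _.
rewrite /= -/(cell t l) shift_cellE linearZ /= !boundaryE.
elim: l => [|J l IH] /=; first by rewrite !linear0.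
by rewrite [in RHS]linearB /= shift_cell_cons shift_cellE -IH scalerBr; congr (_ - _); rewrite linearZ.
Qed.

Lemma ract_is_linear z : linear (ract z).
Proof. exact: lext_is_linear. Qed.
HB.instance Definition _ z := GRing.isLinear.Build k A G _ (ract z) (ract_is_linear z).

Lemma ractB z s : ract z (twbasis c s) = shift_cell s z.
Proof. exact: lextU. Qed.

Lemma ract_linear_l (f : A) : linear (ract^~ f).
Proof.
move=> a y z; rewrite /ract /lext scaler_sumr -big_split; apply: eq_bigr => s _ /=.
by rewrite linearP scalerDr !scalerA mulrC.
Qed.
Definition ractr f z := ract z f.
HB.instance Definition _ f := GRing.isLinear.Build k G G _ (ractr f) (ract_linear_l f).

Lemma boundary_ract z f : boundary (ract z f) = ract (boundary z) f.
Proof.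
rewrite /ract /lext linear_sum; apply: eq_bigr => s _.
by rewrite linearZ /= boundary_shift.
Qed.

Lemma move_setM s t I : move_set (s * t)%g I = move_set t (move_set s I).
Proof. by apply/setP => i; rewrite !inE twistM permM. Qed.

Lemma shift_cellM s t z :
  shift_cell t (shift_cell s z) = c s t *: shift_cell (s * t)%g z.
Proof.
apply: (@linear_malg_eq _ _ _ (shift_cell t \o shift_cell s : {linear G -> G})
          (c s t \*: shift_cell (s * t)%g : {linear G -> G})) => -[u l] _.
rewrite /= -/(cell u l) !shift_cellE linearZ /= !shift_cellE !scalerA.
rewrite -cocycleE -map_comp mulgA; congr (_ *: cell _ _).
by apply: eq_map => I /=; rewrite move_setM.
Qed.

Lemma ractE z f : ract z f = \sum_(s <- msupp f) twcoef s f *: shift_cell s z.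
Proof. by []. Qed.

Lemma ractZr z a f : ract z (a *: f) = a *: ract z f.
Proof. exact: linearZ. Qed.

Lemma ract_sumr z (I : Type) (r : seq I) (F : I -> A) :
  ract z (\sum_(i <- r) F i) = \sum_(i <- r) ract z (F i).
Proof. exact: (linear_sum (ract z)). Qed.

Lemma ractA z (f g : A) : ract (ract z f) g = ract z (f * g).
Proof.
pose F s t := (twcoef s f * twcoef t g) *: shift_cell t (shift_cell s z).
transitivity (\sum_(s <- msupp f) \sum_(t <- msupp g) F s t).
  rewrite exchange_big ractE; apply: eq_bigr => t _.
  rewrite ractE (linear_sum (shift_cell t)) scaler_sumr; apply: eq_bigr => s _.
  by rewrite linearZ /= scalerA mulrC.
rewrite twisted_mulE ract_sumr; apply: eq_bigr => s _.
rewrite ract_sumr; apply: eq_bigr => t _.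
by rewrite ractZr ractB -scalerA -shift_cellM.
Qed.

End Flags.


Section FlagCombinatorics.
Variables (S : monoidType) (n : nat) (C : coordinates S n).
Local Notation T := {set 'I_n}.
Implicit Types (s t : S) (I J : T) (l : seq T).
Local Notation move_set := (move_set C).

Lemma pact_indicator s I :
  pact (twist C s) (indicator I) = indicator (move_set s I).
Proof. by apply/mnmP => i; rewrite !mnmE inE. Qed.

Lemma mdeg_indicator I : mdeg (indicator I) = #|I|.
Proof.
rewrite mpoly.mdegE -sum1_card [RHS]big_mkcond.
by apply: eq_bigr => i _; rewrite mnmE; case: (i \in I).
Qed.

Lemma move_subset s I J : (move_set s I \subset move_set s J) = (I \subset J).
Proof.
apply/subsetP/subsetP => IJ i; last by rewrite !inE => /IJ.
by move=> iI; have := IJ ((twist C s)^-1%g i); rewrite !inE permKV; apply.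
Qed.

Lemma move_proper s I J : (move_set s I \proper move_set s J) = (I \proper J).
Proof. by rewrite !properE !move_subset. Qed.

Lemma move_set_inj s : injective (move_set s).
Proof.
move=> I J IJ; apply/eqP; rewrite eqEsubset -(move_subset s I) -(move_subset s J).
by rewrite IJ subxx.
Qed.

Lemma top_move s l : top (map (move_set s) l) = move_set s (top l).
Proof. by case: l => //=; rewrite /top /= /move_set preimset0. Qed.

Lemma is_flag_move s l : is_flag (map (move_set s) l) = is_flag l.
Proof. by elim: l => //= I l ->; rewrite top_move move_proper. Qed.

Lemma size_flag l : is_flag l -> (size l <= #|top l|)%N.
Proof.
elim: l => //= I l IH /andP[/proper_card lI /IH le_l].
exact: leq_ltn_trans le_l lI.
Qed.

Lemma flag_mem l J : is_flag l -> J \in l -> J != set0 /\ J \subset top l.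
Proof.
elim: l => //= I l IH /andP[lI fl]; rewrite inE => /predU1P[->|/(IH fl)[J0 Jl]].
  rewrite subxx; split => //; apply/eqP => I0.
  by move: lI; rewrite I0 properE sub0set andbC; case: (top l \subset set0).
by split => //; apply: subset_trans Jl (proper_sub lI).
Qed.

(** The smallest element whose face is [I]; the cells [(vertex (top l), l)] form a
    basis of the complex over the algebra. *)
Definition vertex I : S := elt C (indicator I).

Lemma expo_vertexM I s :
  expo C (vertex I * s)%g = (indicator (move_set s I) + expo C s)%MM.
Proof. by rewrite expoM eltK pact_indicator. Qed.

Lemma weight_vertex I : weight C (vertex I) = #|I|.
Proof. by rewrite /weight eltK mdeg_indicator. Qed.

Definition place l s : S * seq T := ((vertex (top l) * s)%g, map (move_set s) l).

(** The cells of the complex, among all pairs of an element and a list of sets. *)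
Definition cubical (p : S * seq T) := is_flag p.2 && (top p.2 \subset supp_set C p.1).

Lemma place_inj l l' s s' : place l s = place l' s' -> l = l' /\ s = s'.
Proof.
case=> e1 e2; have ss' : s = s'.
  have := congr1 (expo C) e1; rewrite !expo_vertexM -!top_move e2.
  by move/addmI/(can_inj (expoK C)).
by split => //; move: e2; rewrite -ss'; exact: inj_map (@move_set_inj s) _ _.
Qed.

Lemma place_cubical l s : is_flag l -> cubical (place l s).
Proof.
move=> fl; rewrite /cubical /= is_flag_move fl /=; apply/subsetP => i.
by rewrite top_move => il; rewrite /supp_set in_set expo_vertexM mnmDE mnmE il.
Qed.

(** The factor is found by removing the vector of the largest set of the flag;
    its twist says which flag to start from. With [place_inj] this makes the
    complex a free right module. *)
Lemma cubical_place p : cubical p ->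
  exists l s, [/\ is_flag l, p = place l s & size l = size p.2].
Proof.
case: p => u l' /andP[/= fl' lu].
have le_lu : (indicator (top l') <= expo C u)%MM.
  apply/mnm_lepP => i; rewrite mnmE; case: (boolP (i \in top l')) => // il.
  by move/subsetP: lu => /(_ _ il); rewrite inE lt0n.
pose s := elt C (expo C u - indicator (top l'))%MM.
pose l := map (fun J : T => [set (twist C s) i | i in J]) l'.
have lE : map (move_set s) l = l'.
  rewrite -map_comp -[RHS]map_id; apply: eq_map => I /=; apply/setP => i.
  by rewrite inE mem_imset //; exact: perm_inj.
exists l, s; split; [by rewrite -(is_flag_move s) lE| |by rewrite size_map].
congr pair => //; apply: (can_inj (expoK C)).
by rewrite expo_vertexM -top_move lE eltK addmC submK.
Qed.

Lemma flags_finite : exists N (fl : 'I_N -> seq T),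
  injective fl /\ forall l, is_flag l <-> exists a, fl a = l.
Proof.
pose F := {l : n.-bseq T | is_flag l}.
exists #|{: F}|, (fun a => val (val (enum_val a : F)) : seq T); split.
  by move=> a b /val_inj/val_inj/enum_val_inj.
move=> l; split=> [fl|[a <-]]; last exact: (valP (enum_val a)).
have sl : (size l <= n)%N.
  by apply: leq_trans (size_flag fl) _; rewrite -[X in (_ <= X)%N]card_ord max_card.
pose x : F := exist _ (Bseq sl) fl.
by exists (enum_rank x); rewrite enum_rankK.
Qed.

End FlagCombinatorics.

(** * The flag complex is a free resolution *)

Section Resolution.
Variables (k : fieldType) (S : monoidType) (n : nat) (C : coordinates S n).
Variable c : cocycle k S.
Local Notation A := (twisted c).
Local Notation T := {set 'I_n}.
Local Notation G := {malg k[(S * seq {set 'I_n})%type]}.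
Local Notation cell := (@cell k S n).
Local Notation cons_cell := (@cons_cell k S n).
Local Notation boundary := (@boundary k S n).
Local Notation boundary_cell := (@boundary_cell k S n).
Local Notation ract := (@ract k S n C c).
Variables (N : nat) (fl : 'I_N -> seq {set 'I_n}).
Hypotheses (fl_inj : injective fl) (flP : forall l, is_flag l <-> exists a, fl a = l).
Implicit Types (z : 'cV[A]_N) (w : G) (s t u : S) (l : seq T).

Let fl_flag a : is_flag (fl a). Proof. by apply/flP; exists a. Qed.

Definition size_deg (a : 'I_N) := size (fl a).
Definition top_deg (a : 'I_N) := #|top (fl a)|.
Local Notation vert a := (vertex C (top (fl a))).

Definition generator (a : 'I_N) : G := cell (vert a) (fl a).

(** The chain with coordinates [z] on the free generators. *)
Definition chain_of z : G := \sum_a ract (generator a) (z a 0).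

Lemma mcoeff_cell p (q : S * seq T) : mcoeff p (mkmalgU q 1 : G) = (p == q)%:R.
Proof. by rewrite mcoeffU eq_sym; case: eqP. Qed.

Let ract_generator a (f : A) : ract (generator a) f =
  \sum_(s <- msupp f) (twcoef s f * c (vert a) s) *: (mkmalgU (place C (fl a) s) 1 : G).
Proof.
apply: eq_bigr => s _; rewrite /generator shift_cellE scalerA; congr (_ *: _).
Qed.

Lemma mcoeff_chain_of z a t : mcoeff (place C (fl a) t) (chain_of z) = c (vert a) t * twcoef t (z a 0).
Proof.
rewrite /chain_of raddf_sum (bigD1 a) //= [X in _ + X]big1 ?addr0 => [|b ba].
  rewrite ract_generator raddf_sum /=.
  rewrite (eq_bigr (fun s => twcoef s (z a 0) * c (vert a) s * (s == t)%:R)).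
    case: (msuppP (z a 0) t) => [ta|nta].
      rewrite (big_fsetD1 t) //= eqxx mulr1 big_seq big1 ?addr0 1?mulrC //.
      by move=> u; rewrite !inE => /andP[/negbTE -> _]; rewrite mulr0.
    rewrite /twcoef (mcoeff_outdom nta) mulr0 big_seq big1 // => u uf.
    by case: eqP => [ut|]; rewrite ?mulr0 // -ut uf in nta *.
  move=> s _; rewrite mcoeffZ mcoeff_cell; congr (_ * (nat_of_bool _)%:R).
  by apply/eqP/eqP => [/place_inj[_ ->]|->].
rewrite ract_generator raddf_sum big1 //= => s _.
rewrite mcoeffZ mcoeff_cell.
case: eqP => [/place_inj[/fl_inj ab _]|_]; last by rewrite mulr0.
by rewrite ab eqxx in ba.
Qed.

Lemma chain_of_supp z p : mcoeff p (chain_of z) != 0 ->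
  exists a t, p = place C (fl a) t /\ twcoef t (z a 0) != 0.
Proof.
move=> h; apply: NNPP => nh; case/negP: h; apply/eqP.
rewrite /chain_of raddf_sum big1 //= => a _; rewrite ract_generator raddf_sum /=.
rewrite big_seq big1 // => s sz; rewrite mcoeffZ mcoeff_cell.
case: eqP => [ps|_]; last by rewrite mulr0.
by case: nh; exists a, s; rewrite mcoeff_neq0.
Qed.

Lemma chain_of_additive : additive chain_of.
Proof.
move=> y z; rewrite /chain_of -sumrB; apply: eq_bigr => a _.
by rewrite !mxE raddfB.
Qed.
HB.instance Definition _ := GRing.isAdditive.Build 'cV[A]_N G chain_of chain_of_additive.

Lemma chain_of_inj : injective chain_of.
Proof.
apply: raddf_inj => z z0; apply/colP => a; rewrite mxE; apply: twcoefP => t.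
apply/eqP; rewrite raddf0 -(mulrI_eq0 _ (lregP (cocycle_neq0 c (vert a) t))).
by rewrite -mcoeff_chain_of z0 mcoeff0.
Qed.

Definition cubical_chain w := forall p, mcoeff p w != 0 -> cubical C p.

Lemma chain_of_cubical z : cubical_chain (chain_of z).
Proof. by move=> p /chain_of_supp[a [t [-> _]]]; exact: place_cubical. Qed.

Lemma chain_of_surj w : cubical_chain w -> exists z, w = chain_of z.
Proof.
move=> cw; rewrite [w]malg_sum_cells big_seq.
elim/big_ind: _ => [|_ _ [y ->] [z ->]|p pw].
- by exists 0; rewrite raddf0.
- by exists (y + z); rewrite raddfD.
have /cubical_place[l [s [/flP[a <-] pE _]]] : cubical C p.
  by apply: cw; rewrite mcoeff_neq0.
pose al := mcoeff p w / c (vert a) s.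
exists (\col_b (if b == a then al *: twbasis c s else 0)).
rewrite /chain_of (bigD1 a) //= [X in _ + X]big1 => [|b /negbTE ba]; last first.
  by rewrite mxE ba linear0.
rewrite addr0 mxE eqxx.
rewrite ractZr ractB /generator shift_cellE.
rewrite scalerA.
have -> : al * c (vert a) s = mcoeff p w by apply: divfK; exact: cocycle_neq0.
by congr (_ *: _); rewrite pE.
Qed.

Lemma chain_of_mulr z (f : A) : chain_of (\col_a (z a 0 * f)) = ract (chain_of z) f.
Proof.
rewrite -[RHS]/(ractr C f (chain_of z)) linear_sum; apply: eq_bigr => a _.
by rewrite mxE /= /ractr ractA.
Qed.

Lemma cons_cell_supp J w p : mcoeff p (cons_cell J w) != 0 ->
  exists2 q, mcoeff q w != 0 & p = (q.1, J :: q.2).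
Proof.
move/lext_supp=> [q qw]; rewrite mcoeff_cell.
by case: (p =P _) => [->|]; [exists q|rewrite eqxx].
Qed.

Lemma boundary_cell_supp s l p : mcoeff p (boundary_cell s l) != 0 ->
  [/\ p.1 = s, subseq p.2 l & size l = (size p.2).+1].
Proof.
elim: l p => [|J l IH] p /=; first by rewrite mcoeff0 eqxx.
rewrite mcoeffB mcoeff_cell; case: (p =P (s, l)) => [-> _|_].
  by split=> //; exact: subseq_cons.
rewrite sub0r oppr_eq0 => /cons_cell_supp[q /IH[qs ql ->] ->].
by rewrite qs /= eqxx.
Qed.

Lemma boundary_cell_flag s l p : is_flag l -> mcoeff p (boundary_cell s l) != 0 ->
  is_flag p.2 /\ top p.2 \subset top l.
Proof.
elim: l p => [|J l IH] p /=; first by rewrite mcoeff0 eqxx.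
case/andP=> lJ fl'; rewrite mcoeffB mcoeff_cell; case: (p =P (s, l)) => [-> _|_].
  by rewrite (proper_sub lJ).
rewrite sub0r oppr_eq0 => /cons_cell_supp[q /(IH _ fl')[fq tq] ->].
by rewrite /= fq (sub_proper_trans tq lJ) subxx.
Qed.

(** For a fixed [s] the flags form the barycentric subdivision of the full simplex
    on [supp_set C s], which is a cone with apex the whole face. *)
Definition homotopy : G -> G := lext (fun p =>
  if top p.2 == supp_set C p.1 then 0 else cell p.1 (supp_set C p.1 :: p.2)).
HB.instance Definition _ := GRing.Linear.on homotopy.

Lemma homotopyE s l : homotopy (cell s l) =
  if top l == supp_set C s then 0 else cell s (supp_set C s :: l).
Proof. exact: lextU. Qed.

Lemma homotopy_cons s w :
  (forall p, mcoeff p w != 0 -> p.1 = s /\ top p.2 != supp_set C s) ->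
  homotopy w = cons_cell (supp_set C s) w.
Proof.
move=> ws; apply: (@linear_malg_eq _ _ _ (homotopy : {linear G -> G})
   (cons_cell (supp_set C s) : {linear G -> G})) => -[t l] pw.
have [/= ts /negbTE tl] := ws (t, l) (etrans (mcoeff_neq0 _ _) pw).
by rewrite /= -/(cell t l) homotopyE cons_cellE ts tl.
Qed.

Lemma homotopy_cons0 s w : (forall p, mcoeff p w != 0 -> p.1 = s) ->
  homotopy (cons_cell (supp_set C s) w) = 0.
Proof.
move=> ws; apply: (@linear_malg_eq _ _ _
   (homotopy \o cons_cell (supp_set C s) : {linear G -> G}) \0) => -[t l] pw.
have /= ts := ws (t, l) (etrans (mcoeff_neq0 _ _) pw).
by rewrite /= -/(cell t l) cons_cellE homotopyE ts eqxx.
Qed.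

(** The cone formula. If the flag starts with the apex, the boundary face without
    the apex is the only one whose cone is not zero; otherwise no face contains
    the apex. *)
Lemma homotopy_boundary s l : cubical C (s, l) -> supp_set C s != set0 ->
  boundary (homotopy (cell s l)) + homotopy (boundary_cell s l) = cell s l.
Proof.
case/andP=> /= fl_l ls s0; set B := supp_set C s.
have notB l' l2 : is_flag l' -> top l' \subset B -> B \notin l' ->
    subseq l2 l' -> top l2 != B.
  move=> fl' l'B nB pl'; apply/eqP => pB; move: nB; rewrite -pB.
  case: l2 pl' pB => [_ /esym/eqP|J l'' pl' _]; first by rewrite (negbTE s0).
  by rewrite (mem_subseq pl') // mem_head.
rewrite homotopyE; case: eqP => [lB|/eqP lB].
  case: l fl_l ls lB => [_ _ /esym/eqP|J l]; first by rewrite (negbTE s0).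
  move=> /andP[lJ fl'] _; rewrite {1}/top /= => JB; rewrite {J}JB in lJ *.
  have nB : B \notin l.
    apply/negP => /(flag_mem fl')[_ Bl].
    by have := sub_proper_trans Bl lJ; rewrite properxx.
  rewrite linear0 add0r linearB /= homotopyE -/B.
  rewrite (negbTE (notB l l fl' (proper_sub lJ) nB (subseq_refl _))).
  rewrite homotopy_cons0 ?subr0 // => p.
  by case/boundary_cell_supp.
have nB : B \notin l.
  apply/negP => /(flag_mem fl_l)[_ Bl]; case/negP: lB.
  by rewrite eqEsubset ls.
rewrite boundaryE /= (@homotopy_cons s) ?subrK // => p /boundary_cell_supp[-> pl _].
by split => //; exact: (notB l).
Qed.

Lemma homotopy_cubical w : cubical_chain w -> cubical_chain (homotopy w).
Proof.
move=> cw p /lext_supp[q /cw/andP[fq tq]].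
case: (top q.2 =P _) => [_|/eqP nq]; first by rewrite mcoeff0 eqxx.
rewrite mcoeff_cell; case: (p =P _) => [->|]; last by rewrite eqxx.
by rewrite /cubical /= fq properEneq nq tq /= /top /=.
Qed.

Lemma boundary_exact w : cubical_chain w ->
  (forall p, mcoeff p w != 0 -> supp_set C p.1 != set0) ->
  boundary w = 0 -> w = boundary (homotopy w).
Proof.
move=> cw w0 bw; rewrite -[RHS]addr0 -[X in _ + X](linear0 homotopy) -bw.
apply/esym; apply: (@linear_malg_eq _ _ _
   ((boundary \o homotopy) \+ (homotopy \o boundary) : {linear G -> G}) idfun).
move=> [s l]; rewrite -mcoeff_neq0 => pw /=; rewrite -/(cell s l) boundaryE.
by apply: homotopy_boundary; [exact: cw|exact: (w0 (s, l))].
Qed.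

Lemma boundary_generator_cubical a : cubical_chain (boundary (generator a)).
Proof.
move=> p; rewrite boundaryE => pb; have [ps _ _] := boundary_cell_supp pb.
have [fp tp] := boundary_cell_flag (fl_flag a) pb.
rewrite /cubical fp /= ps; apply: subset_trans tp _; apply/subsetP => i ia.
by rewrite /supp_set in_set /vertex eltK mnmE ia.
Qed.

(** The boundary of a generator is a chain, so it has coordinates; they are the
    columns of the differential. *)
Lemma differential_exists : exists D : 'M[A]_N,
  forall a, boundary (generator a) = chain_of (col a D).
Proof.
have h a : exists y, boundary (generator a) = chain_of y.
  by apply: chain_of_surj; exact: boundary_generator_cubical.
have [d dP] := functional_choice _ h.
exists (\matrix_(b, a) d a b 0) => a; rewrite dP; congr chain_of.
by apply/colP => b; rewrite !mxE.
Qed.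

Section Differential.
Variable D : 'M[A]_N.
Hypothesis DP : forall a, boundary (generator a) = chain_of (col a D).

Lemma chain_of_differential z : chain_of (D *m z) = boundary (chain_of z).
Proof.
rewrite {2}/chain_of linear_sum.
have -> : D *m z = \sum_a \col_b (col a D b 0 * z a 0).
  by apply/colP => b; rewrite summxE mxE; apply: eq_bigr => a _; rewrite !mxE.
rewrite raddf_sum; apply: eq_bigr => a _.
by rewrite -[LHS]/(chain_of _) chain_of_mulr -DP -boundary_ract.
Qed.

Lemma differential_supp a b t : twcoef t (D a b) != 0 ->
  (weight C t + top_deg a)%N = top_deg b /\ size_deg b = (size_deg a).+1.
Proof.
move=> Dab; have: mcoeff (place C (fl a) t) (chain_of (col b D)) != 0.
  by rewrite mcoeff_chain_of mxE mulf_neq0 ?cocycle_neq0.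
rewrite -DP boundaryE => /boundary_cell_supp[/= e _ sz].
split; last by rewrite /size_deg sz size_map.
by rewrite /top_deg -!(weight_vertex C) -e weightM addnC.
Qed.

Lemma differential_square : D *m D = 0.
Proof.
apply/matrixP => a b; rewrite [RHS]mxE.
have: D *m col b D = 0.
  by apply: chain_of_inj; rewrite chain_of_differential -DP boundary_boundary raddf0.
by move/colP/(_ a); rewrite !mxE => h; rewrite -[RHS]h; refine (eq_bigr _ _) => j _; rewrite mxE.
Qed.

Lemma differential_exact d z : (0 < d)%N ->
  (forall a t, twcoef t (z a 0) != 0 -> (weight C t + top_deg a)%N = d) ->
  D *m z = 0 -> exists z', z = D *m z'.
Proof.
move=> d0 hz Dz; have: boundary (chain_of z) = 0.
  by rewrite -chain_of_differential Dz raddf0.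
move/(boundary_exact (@chain_of_cubical z)) => e.
have [z' z'E] := chain_of_surj (homotopy_cubical (@chain_of_cubical z)).
exists z'; apply: chain_of_inj; rewrite chain_of_differential -z'E; apply: e.
move=> p /chain_of_supp[a [t [-> /hz hd]]] /=; apply/eqP => s0.
move: d0; rewrite -hd /top_deg -(weight_vertex C) addnC -weightM /weight.
rewrite lt0n mpoly.mdeg_eq0 => /eqP[]; apply/mnmP => i; rewrite mnm0E.
apply/eqP; apply: NNPP => /negP ei.
by have := in_set0 i; rewrite -s0 inE ei.
Qed.

End Differential.

End Resolution.

(** * Exactness in large degrees of the complex tensored with a module *)

Section GradedResolution.
Variables (k : fieldType) (S : monoidType) (n : nat) (C : coordinates S n).
Variable c : cocycle k S.
Local Notation A := (twisted c).

(** A finite resolution of the trivial right module by graded free right modules.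
    All homological degrees share one square matrix, and [cell_dim] tells them
    apart; [cell_deg] is the internal degree of a generator. *)
Record graded_resolution := GradedResolution {
  cells : nat;
  cell_deg : 'I_cells -> nat;
  cell_dim : 'I_cells -> nat;
  differential : 'M[A]_cells;
  differential_degree : forall a b t, twcoef t (differential a b) != 0 ->
    (weight C t + cell_deg a)%N = cell_deg b /\ cell_dim b = (cell_dim a).+1;
  differential2 : differential *m differential = 0;
  differential_acyclic : forall d (z : 'cV[A]_cells), (0 < d)%N ->
    (forall a t, twcoef t (z a 0) != 0 -> (weight C t + cell_deg a)%N = d) ->
    differential *m z = 0 -> exists z', z = differential *m z';
  base_cell : 'I_cells;
  cell_deg_eq0 : forall a, (cell_deg a == 0%N) = (a == base_cell);
  cell_dim_eq0 : forall a, (cell_dim a == 0%N) = (a == base_cell);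
  cell_dim_le : forall a, (cell_dim a <= n)%N
}.

Lemma flag_resolution : graded_resolution.
Proof.
have [N [fl [fl_inj flP]]] : {N & {fl : 'I_N -> seq {set 'I_n} |
    injective fl /\ forall l, is_flag l <-> exists a, fl a = l}}.
  have [N h] := constructive_indefinite_description _ (@flags_finite n).
  by exists N; apply: constructive_indefinite_description.
have [D DP] := constructive_indefinite_description _
  (differential_exists C c flP).
have [o oE] : {o | fl o = [::]}.
  by apply: constructive_indefinite_description; apply/flP.
have fl_flag a : is_flag (fl a) by apply/flP; exists a.
have flo a : (fl a == [::]) = (a == o) by rewrite -oE (inj_eq fl_inj).
apply: (@GradedResolution N (top_deg fl) (size_deg fl) D _ _ _ o).
- by move=> a b t; exact: differential_supp.
- exact: differential_square DP.
- by move=> d z; exact: differential_exact DP d z.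
- move=> a; rewrite -flo /top_deg cards_eq0; have := fl_flag a.
  case: (fl a) => [|J l]; first by rewrite /top /= eqxx.
  move=> /andP[lJ _]; apply/eqP => J0.
  by move: lJ; rewrite (J0 : J = set0) properE sub0set andbF.
- by move=> a; rewrite -flo size_eq0.
move=> a; apply: leq_trans (size_flag (fl_flag a)) _.
by rewrite -[X in (_ <= X)%N]card_ord max_card.
Qed.

Variable R : graded_resolution.
Local Notation N := (cells R).
Local Notation D := (differential R).
Local Notation gd := (cell_deg (g := R)).
Local Notation sz := (cell_dim (g := R)).

Section Chains.
Variables (r : nat) (e : 'I_r -> nat).
Implicit Types (Y : 'M[A]_(N, r)) (d i : nat).

(** The columns of [Y] are chains with values in a free left module whose [b]-th
    generator has degree [e b]; all entries live in total degree [d] and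
    homological degree [i]. *)
Definition homog_chain d i Y := forall a b t, twcoef t (Y a b) != 0 ->
  (weight C t + gd a + e b)%N = d /\ sz a = i.

Definition chain_part d i Y : 'M[A]_(N, r) := \matrix_(a, b)
  if sz a == i then restrict (fun t => weight C t + gd a + e b == d)%N (Y a b)
  else 0.

Lemma chain_part_chain d i Y : homog_chain d i (chain_part d i Y).
Proof.
move=> a b t; rewrite mxE; case: (sz a =P i) => [ai|_]; last by rewrite twcoef0 eqxx.
by rewrite twcoef_restrict; case: (_ =P d) => [->|_]; rewrite ?eqxx.
Qed.

Lemma chain_part_id d i Y : homog_chain d i Y -> chain_part d i Y = Y.
Proof.
move=> cY; apply/matrixP => a b; rewrite mxE; case: eqP => [_|ai].
  by apply: restrict_id => t /cY[-> _].
apply: twcoefP => t; rewrite twcoef0; apply/esym/eqP; apply: NNPP => /negP/cY[_].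
exact: ai.
Qed.

Lemma chain_part_differential d i Y :
  chain_part d i (D *m Y) = D *m chain_part d i.+1 Y.
Proof.
apply/matrixP => a b; rewrite !mxE.
have D0 a' b' : sz b' != (sz a').+1 -> D a' b' = 0.
  move=> ab; apply: twcoefP => t; rewrite twcoef0; apply/eqP; apply: NNPP.
  by move/negP/differential_degree=> [_ h]; rewrite h eqxx in ab.
case: eqP => [ai|ai]; last first.
  rewrite big1 // => b' _; rewrite mxE; case: (sz b' =P i.+1) => [bi|]; last by rewrite mulr0.
  by rewrite D0 ?mul0r // bi eqSS; apply/eqP => ia; apply: ai.
rewrite linear_sum; refine (eq_bigr _ _) => b' _; rewrite mxE /=.
case: (sz b' =P i.+1) => [bi|/eqP bi]; last by rewrite mulr0 D0 ?mul0r ?linear0 ?ai.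
apply: restrict_mull => s t /differential_degree[<- _].
by rewrite weightM; congr (_ == d); lia.
Qed.

Lemma chain0_differential d Y : homog_chain d 0 Y -> D *m Y = 0.
Proof.
move=> cY; apply/matrixP => a b; rewrite !mxE big1 // => b' _.
apply: twcoefP => t; rewrite twcoef0; apply/eqP; apply: NNPP => /negP.
case/twcoef_mul_neq0 => [s [u [_ /differential_degree[_ h] /cY[_]]]].
by rewrite h.
Qed.

Lemma chainB d i Y Z : homog_chain d i Y -> homog_chain d i Z -> homog_chain d i (Y - Z).
Proof.
move=> cY cZ a b t; rewrite !mxE twcoefB /=.
case: (eqVneq (twcoef t (Y a b)) 0) => [->|/cY //].
by rewrite sub0r oppr_eq0 => /cZ.
Qed.

(** In total degree [e b] the [b]-th column sits in internal degree 0, where only the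
    base cell contributes, and exactness fails for it in homological degree 0. *)
Lemma chain_exact d i Y : homog_chain d i Y -> D *m Y = 0 ->
  (0 < i)%N \/ (forall b, (e b < d)%N) ->
  exists2 Z, homog_chain d i.+1 Z & Y = D *m Z.
Proof.
move=> cY DY big; have [Z ZP] : exists Z : 'I_r -> 'cV[A]_N,
    forall b, col b Y = D *m Z b.
  apply: (functional_choice (fun b z => col b Y = D *m z)) => b.
  have DYb : D *m col b Y = 0.
    by rewrite colE mulmxA DY mul0mx.
  case: (ltnP (e b) d) => [ebd|deb].
    apply: (@differential_acyclic R (d - e b)%N); rewrite ?subn_gt0 //.
    by move=> a t; rewrite mxE => /cY[<- _]; rewrite addnK.
  exists 0; rewrite mulmx0; apply/colP => a; rewrite !mxE; apply: twcoefP => t.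
  rewrite twcoef0; apply/eqP; apply: NNPP => /negP/cY[ed ai].
  case: big => [i0|/(_ b)]; last by rewrite ltnNge deb.
  have: gd a == 0%N by lia.
  by rewrite cell_deg_eq0 -cell_dim_eq0 ai; case: (i) i0.
pose Z' := \matrix_(a, b) Z b a 0.
have YZ : Y = D *m Z'.
  apply/matrixP => a b; have /colP/(_ a) := ZP b; rewrite !mxE => ->.
  by refine (eq_bigr _ _) => j _; rewrite mxE.
exists (chain_part d i.+1 Z'); first exact: chain_part_chain.
by rewrite -chain_part_differential -YZ chain_part_id.
Qed.

End Chains.

Definition graded_matrix r r' (e : 'I_r -> nat) (e' : 'I_r' -> nat) (F : 'M[A]_(r, r')) :=
  forall b l t, twcoef t (F b l) != 0 -> (weight C t + e' l)%N = e b.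

Lemma chain_part_mulr r r' (e : 'I_r -> nat) (e' : 'I_r' -> nat) (F : 'M[A]_(r, r'))
    d i (Y : 'M[A]_(N, r)) : graded_matrix e e' F ->
  chain_part e' d i (Y *m F) = chain_part e d i Y *m F.
Proof.
move=> gF; apply/matrixP => a l; rewrite !mxE.
case: eqP => ai; last first.
  by rewrite big1 // => b _; rewrite mxE (introF eqP ai) mul0r.
rewrite linear_sum; refine (eq_bigr _ _) => b _; rewrite mxE /= (introT eqP ai).
apply: restrict_mulr => s t /gF <-.
by rewrite weightM; congr (_ == d); lia.
Qed.

Variable m : nat.
Hypotheses (m_gt0 : (0 < m)%N)
           (untwisted : forall a, twist C (elt C (a *+ m)%MM) = 1%g).

(** The chains [Y *m F] are those with values in the left module [M] generated by the
    rows of [F]. Let [G] generate the syzygies of these rows. A cycle [Y *m F]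
    with values in [M] has [D *m Y] with values in the syzygies, one
    homological degree lower; there it is a boundary [D *m (Z *m G)] by
    induction. So [Y - Z *m G] is a cycle with values in a free module, hence a
    boundary, and it has the same image in [M] as [Y]. In homological degree 0
    the statement is that [M] is generated in bounded degrees. *)
Lemma eventually_exact i r r' (e : 'I_r -> nat) (e' : 'I_r' -> nat) (F : 'M[A]_(r, r')) :
  graded_matrix e e' F -> exists d0, forall d Y, (d0 <= d)%N -> homog_chain e d i Y ->
    D *m (Y *m F) = 0 -> exists2 Z, homog_chain e d i.+1 Z & Y *m F = D *m Z *m F.
Proof.
elim: i r r' e e' F => [|i IH] r r' e e' F gF.
  exists (\max_b e b).+1 => d Y dd cY _.
  have [|Z cZ ->] := chain_exact cY (chain0_differential cY); last by exists Z.
  by right=> b; apply: leq_trans dd; rewrite ltnS; exact: leq_bigmax.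
pose P (y : 'rV[A]_r) := y *m F = 0.
have PD y z : P y -> P z -> P (y + z).
  by rewrite /P => y0 z0; rewrite mulmxDl y0 z0 addr0.
have PZ f y : P y -> P (f *: y).
  by rewrite /P => y0; rewrite -scalemxAl y0 scaler0.
have [r1 [e1 [G [GP gen]]]] := graded_submodule_fg m_gt0 untwisted e PD PZ.
have gG : graded_matrix e1 e G.
  move=> j b t Gjb; have [_ h] := GP j; apply: h.
  by rewrite mxE.
have GF : G *m F = 0.
  by apply/row_matrixP => j; rewrite row_mul row0; case: (GP j).
have [d0 d0P] := IH _ _ _ _ _ gG; exists d0 => d Y dd cY DYF.
have cDY : homog_chain e d i (D *m Y).
  rewrite -(chain_part_id cY) -chain_part_differential.
  exact: chain_part_chain.
have [Y1 Y1P] : exists Y1 : 'I_N -> 'rV[A]_r1, forall a, row a (D *m Y) = Y1 a *m G.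
  apply: (functional_choice (fun a y => row a (D *m Y) = y *m G)) => a.
  apply: (gen (d - gd a)%N); first by rewrite /P -row_mul -mulmxA DYF row0.
  by move=> b t; rewrite mxE => /cDY[<- _]; rewrite addnAC addnK.
pose Y2 := chain_part e1 d i (\matrix_a Y1 a).
have Y2G : D *m Y = Y2 *m G.
  rewrite -(chain_part_mulr _ _ _ gG) -[LHS](chain_part_id cDY).
  by congr chain_part; apply/row_matrixP => a; rewrite Y1P row_mul rowK.
have [|Z cZ Z2] := d0P d Y2 dd (@chain_part_chain _ _ _ _ _).
  by rewrite -Y2G mulmxA differential2 mul0mx.
have cZG : homog_chain e d i.+1 (Z *m G).
  by rewrite -(chain_part_id cZ) -(chain_part_mulr _ _ _ gG); exact: chain_part_chain.
have [||X cX XE] := chain_exact (chainB cY cZG); last 1 first.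
- by exists X => //; rewrite -XE mulmxBl -(mulmxA Z) GF mulmx0 subr0.
- by rewrite mulmxBr Y2G Z2 mulmxA subrr.
- by left.
Qed.

End GradedResolution.

(** * Hilbert functions and their growth *)

Section Counting.
Local Open Scope nat_scope.

Definition cum (f : nat -> nat) d := \sum_(i < d.+1) f i.

Lemma cum0 f : cum f 0 = f 0.
Proof. by rewrite /cum big_ord_recr big_ord0. Qed.

Lemma cumS f d : cum f d.+1 = cum f d + f d.+1.
Proof. by rewrite /cum big_ord_recr. Qed.

Lemma cum_mono f d d' : d <= d' -> cum f d <= cum f d'.
Proof.
elim: d' => [|d' IH]; first by rewrite leqn0 => /eqP ->.
rewrite leq_eqVlt => /predU1P[-> //|/IH h].
by rewrite cumS; apply: leq_trans h (leq_addr _ _).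
Qed.

Lemma cum_dilate f h w m : 0 < m -> (forall d, f d <= h (w + d * m)) ->
  forall d, cum f d <= cum h (w + d * m).
Proof.
move=> m0 fh; elim=> [|d IH].
  rewrite cum0 mul0n addn0; apply: leq_trans (fh 0) _; rewrite mul0n addn0.
  by case: w {fh} => [|w]; rewrite ?cum0 ?cumS ?leq_addl.
have e : w + d.+1 * m = (w + d * m + m.-1).+1.
  by rewrite -addnS prednK // mulSn; lia.
rewrite cumS e cumS -e; apply: leq_add (fh _).
by apply: leq_trans IH (cum_mono _ (leq_addr _ _)).
Qed.

(** The number of monomials of degree [d] in [n] variables. *)
Definition monomial_count n d :=
  #|[set t : n.-tuple 'I_d.+1 | \sum_(i <- t) i == d]|.

Lemma cum_monomial_count n d : cum (monomial_count n) d = 'C(n + d, n).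
Proof.
rewrite /cum /monomial_count; case: n => [|n].
  rewrite bin0 big_ord_recl /= big1 ?addn0 => [|i _].
    rewrite -[RHS](card_tuple 0 'I_1) -cardsT; congr #|pred_of_set _|.
    by apply/setP => t; rewrite !inE tuple0 big_nil.
  by apply: eq_card0 => t; rewrite !inE tuple0 big_nil.
under eq_bigr do rewrite card_ord_partitions.
elim: d => [|d IH]; first by rewrite big_ord_recr big_ord0 /= !addn0 !binn.
by rewrite big_ord_recr /= IH [n.+1 + d.+1]addnS binS addnS.
Qed.

Lemma leq_bin_expn N n : 'C(N, n) <= N ^ n.
Proof.
apply: (@leq_trans (N ^_ n)); first by rewrite -bin_ffact leq_pmulr ?fact_gt0.
rewrite ffact_prod -[X in _ <= X ^ _](subn0 N) -[X in _ <= _ ^ X]card_ord.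
rewrite -prod_nat_const; apply: leq_prod => i _.
by rewrite subn0 leq_subr.
Qed.

Lemma expn_leq_bin n d : d.+1 ^ n <= 'C(n + d, n) * n`!.
Proof.
rewrite bin_ffact ffact_prod -[X in _ ^ X <= _]card_ord -prod_nat_const.
by apply: leq_prod => i _; have := ltn_ord i; lia.
Qed.

(** The left-hand side is a polynomial in [d] of degree [n], the right-hand side one
    of degree [n + 1]. *)
Lemma bin_growth n K w m : exists d, K * 'C(n + (w + d * m), n) < 'C(n.+1 + d, n.+1).
Proof.
have mono a b e : a <= b -> a ^ e <= b ^ e by case: e => // e ab; rewrite leq_exp2r.
apply: NNPP => h; pose L := K * (n + w + m) ^ n * n.+1`!.
apply: h; exists L; rewrite ltnNge; apply/negP => h.
have := expn_leq_bin n.+1 L; apply/negP; rewrite -ltnNge.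
apply: (@leq_ltn_trans (K * ((n + w + m) * L.+1) ^ n * n.+1`!)).
  rewrite leq_mul2r; apply/orP; right; apply: leq_trans h _.
  rewrite leq_mul2l; apply/orP; right; apply: leq_trans (leq_bin_expn _ _) _.
  by apply: mono; nia.
rewrite expnMn mulnA [_ * n.+1`!]mulnAC -/L expnS ltn_mul2r expn_gt0 /=.
by rewrite ltnS.
Qed.

End Counting.

Section Convolution.
Import Num.Theory.

Definition conv (p : {poly int}) (f : nat -> nat) d : int :=
  \sum_(j < d.+1) p`_j * (f (d - j)%N)%:Z.

Lemma conv_cum p f h : (forall d, (h d)%:Z = conv p f d) ->
  forall d, (cum h d)%:Z = conv p (cum f) d.
Proof.
move=> hE; elim=> [|d IH].
  by rewrite cum0 hE /conv !big_ord_recr !big_ord0 /= cum0.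
rewrite cumS PoszD IH hE /conv [in RHS]big_ord_recr [X in _ + X]big_ord_recr /=.
rewrite subnn cum0 addrA; congr (_ + _); rewrite -big_split /=.
apply: eq_bigr => j _; rewrite -mulrDr -PoszD subSn ?cumS //.
by rewrite -ltnS.
Qed.

Lemma conv_size p f d : conv p f d =
  \sum_(j < size p) p`_j * (if (j <= d)%N then (f (d - j)%N)%:Z else 0).
Proof.
pose F j := p`_j * (if (j <= d)%N then (f (d - j)%N)%:Z else 0).
pose M := maxn d.+1 (size p).
transitivity (\sum_(j < M) F j).
  rewrite /conv (big_ord_widen M (fun j => p`_j * (f (d - j)%N)%:Z)) ?leq_maxl //.
  rewrite big_mkcond; apply: eq_bigr => j _; rewrite /F ltnS.
  by case: ifP; rewrite ?mulr0.
rewrite [RHS](big_ord_widen M F) ?leq_maxr // [RHS]big_mkcond.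
apply: eq_bigr => j _; case: ifP => // /negbT; rewrite -leqNgt => jp.
by rewrite /F nth_default ?mul0r.
Qed.

(** Up to the nonpositive term [p.[1] * cum u d], the convolution with [p] is a
    combination of differences [cum u d - cum u (d - j)], each at most
    [j * u d]. *)
Lemma conv_cum_bound (p : {poly int}) u h : (forall d d', (d <= d')%N -> (u d <= u d')%N) ->
  (p.[1] <= 0)%R -> (forall d, (h d)%:Z = conv p (cum u) d) ->
  exists K, forall d, (h d <= K * u d)%N.
Proof.
move=> um p1 hE; exists (\sum_(j < size p) absz (p`_j)%R * j)%N => d.
have step j : (cum u d <= (if j <= d then cum u (d - j) else 0) + j * u d)%N.
  elim: j => [|j IH]; first by rewrite subn0 mul0n addn0.
  apply: leq_trans IH _; case: (ltngtP j d) => [jd|jd|->].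
  - have -> : (d - j = (d - j.+1).+1)%N by lia.
    rewrite cumS mulSn -addnA leq_add2l leq_add2r.
    by apply: um; lia.
  - by rewrite mulSn; lia.
  - by rewrite subnn cum0 mulSn add0n leq_add2r; apply: um.
rewrite -lez_nat hE conv_size.
have p1E : p.[1] = \sum_(j < size p) p`_j.
  by rewrite horner_coef; apply: eq_bigr => j _; rewrite expr1n mulr1.
apply: (@Order.POrderTheory.le_trans _ _ (p.[1] * (cum u d)%:Z +
   \sum_(j < size p) ((absz (p`_j)%R * j)%N * u d)%N%:Z)).
  rewrite p1E mulr_suml -big_split /=; apply: ler_sum => j _.
  have := step j; set a := if (j <= d)%N then cum u (d - j) else 0%N.
  have -> : (if (j <= d)%N then (cum u (d - j))%:Z else 0) = a%:Z.
    by rewrite /a; case: ifP.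
  have : (a <= cum u d)%N.
    by rewrite /a; case: ifP => // _; apply: cum_mono; exact: leq_subr.
  move: (cum u d) (a) (u d) (nat_of_ord j) (p`_j) => F a' v i x; nia.
rewrite -(big_morph Posz PoszD (erefl _)) -big_distrl /=.
have : (p.[1] * (cum u d)%:Z <= 0)%R by rewrite mulr_le0_ge0.
lia.
Qed.

(** A Hilbert function of nonpositive multiplicity [p.[1]] grows more slowly than
    that of the polynomial ring. Summing twice makes the bounding sequence
    monotone for every [n], including [n = 0]. *)
Lemma hilbert_growth_contradiction n (p : {poly int}) h w m : (0 < m)%N -> (p.[1] <= 0)%R ->
  (forall d, (h d)%:Z = conv p (monomial_count n) d) ->
  (forall d, (monomial_count n d <= h (w + d * m))%N) -> False.
Proof.
move=> m0 p1 hE hw.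
pose u := cum (monomial_count n).
have uE d : u d = 'C(n + d, n) by exact: cum_monomial_count.
have um d d' : (d <= d')%N -> (u d <= u d')%N by exact: cum_mono.
have [K hK] := conv_cum_bound um p1 (conv_cum (conv_cum hE)).
have [d] := bin_growth n K w m; rewrite ltnNge => /negP; apply.
have cuE : cum u d = 'C(n.+1 + d, n.+1).
  rewrite /cum; under eq_bigr do rewrite uE.
  elim: d => [|d IH]; first by rewrite big_ord_recr big_ord0 /= !addn0 !binn.
  by rewrite big_ord_recr /= IH [(n.+1 + d.+1)%N]addnS binS addnS.
rewrite -cuE -uE; apply: leq_trans (hK _).
exact: (cum_dilate m0 (cum_dilate m0 hw)).
Qed.

(** As power series: [chi * f = 1], and [chi * h] is a polynomial [p], so
    [h = p * f]. *)
Lemma conv_inverse (chi : {poly int}) f h d0 :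
  (forall d, conv chi f d = (d == 0%N)%:Z) ->
  (forall d, (d0 <= d)%N -> conv chi h d = 0) ->
  exists p, forall d, (h d)%:Z = conv p f d.
Proof.
move=> chif chih; exists (\poly_(i < d0) conv chi h i) => d.
pose P (g : nat -> nat) := \poly_(i < d.+1) (g i)%:Z.
have convE q g i : (i <= d)%N -> (q * P g)`_i = conv q g i.
  move=> id; rewrite coefM; apply: eq_bigr => j _; rewrite coef_poly.
  by rewrite ltnS (leq_trans (leq_subr _ _) id).
have eqM (q q' r : {poly int}) : (forall i, (i <= d)%N -> q`_i = q'`_i) ->
    (r * q)`_d = (r * q')`_d.
  by move=> qq'; rewrite !coefM; apply: eq_bigr => j _; rewrite qq' ?leq_subr.
rewrite -convE // mulrC.
rewrite (eqM _ (chi * P h)) => [|i id].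
  have -> : P f * (chi * P h) = P h * (chi * P f) by ring.
  rewrite (eqM _ 1).
    by rewrite mulr1 coef_poly ltnSn.
  by move=> i id; rewrite convE // chif coef1; case: eqP.
rewrite coef_poly convE //; case: ltnP => // /chih.
by [].
Qed.

End Convolution.

(** * Homogeneous elements are regular *)

Section Domain.
Variables (k : fieldType) (S : monoidType) (n : nat) (C : coordinates S n).
Variable c : cocycle k S.
Local Notation A := (twisted c).
Implicit Types (f g h y : A) (s t : S) (d : nat).

Definition homogeneous d y := forall t, twcoef t y != 0 -> weight C t = d.

Lemma homogeneous_subspace d : subspace (homogeneous d).
Proof.
split=> [t|a y z hy hz t]; first by rewrite twcoef0 eqxx.
rewrite twcoefD twcoefZ; case: (eqVneq (twcoef t y) 0) => [->|/hy //].
by rewrite mulr0 add0r => /hz.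
Qed.

Lemma homogeneousM d d' f g :
  homogeneous d f -> homogeneous d' g -> homogeneous (d + d') (f * g).
Proof.
by move=> hf hg t /twcoef_mul_neq0[s [u [-> /hf <- /hg <-]]]; rewrite weightM.
Qed.

Definition monomial d : finType :=
  {t : n.-tuple 'I_d.+1 | \sum_(i <- t) (i : nat) == d}%N.

Definition exponents d (x : monomial d) : multinom n :=
  [multinom (tnth (val x) i : nat) | i < n].

Lemma card_monomial d : #|monomial d| = monomial_count n d.
Proof. by rewrite card_sig /monomial_count cardsE. Qed.

Lemma exponents_inj d : injective (@exponents d).
Proof.
move=> x y /mnmP xy; apply: val_inj; apply: eq_from_tnth => i.
by apply: val_inj; have := xy i; rewrite !mnmE.
Qed.

Lemma mdeg_exponents d (x : monomial d) : mdeg (exponents x) = d.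
Proof.
rewrite mpoly.mdegE -[RHS](eqP (valP x)) big_tuple.
by apply: eq_bigr => i _; rewrite mnmE.
Qed.

Lemma exponents_surj d (a : multinom n) : mdeg a = d -> exists x : monomial d, exponents x = a.
Proof.
move=> da; pose t := [tuple (inord (a i) : 'I_d.+1) | i < n].
have ai i : (a i < d.+1)%N.
  by rewrite ltnS -da mpoly.mdegE (bigD1 i) //= leq_addr.
have td : (\sum_(i <- t) (i : nat) == d)%N.
  rewrite big_tuple -[X in _ == X]da mpoly.mdegE; apply/eqP.
  by apply: eq_bigr => i _; rewrite tnth_mktuple inordK.
exists (exist _ t td); apply/mnmP => i.
by rewrite mnmE tnth_mktuple inordK.
Qed.

Lemma dim_homogeneous d : has_dim (homogeneous d) (monomial_count n d).
Proof.
pose b (x : monomial d) := twbasis c (elt C (exponents x)).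
have coefb (a : monomial d -> k) x : twcoef (elt C (exponents x)) (\sum_x a x *: b x) = a x.
  rewrite raddf_sum (bigD1 x) //= big1 ?addr0 => [|y yx].
    by rewrite twcoefZ twcoef_basis eqxx mulr1.
  rewrite twcoefZ twcoef_basis (inj_eq (can_inj (eltK C))) (inj_eq (@exponents_inj _)).
  by rewrite (negbTE yx) mulr0.
have bP x : homogeneous d (b x).
  move=> t; rewrite twcoef_basis; case: (elt C _ =P t) => [<- _|]; last by rewrite eqxx.
  by rewrite /weight eltK mdeg_exponents.
rewrite -card_monomial; apply: (has_dim_fin (b := b)) => [a a0 x|y].
  by rewrite -(coefb a) a0 twcoef0.
split=> [hy|[a ->]]; last first.
  have sh := homogeneous_subspace d.
  by apply: subspace_sum => // x _; exact: (subspaceZ _ sh (bP x)).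
exists (fun x => twcoef (elt C (exponents x)) y); apply: twcoefP => t.
case: (eqVneq (weight C t) d) => [td|td].
  by have [x xt] := exponents_surj td; rewrite -(expoK C t) -xt coefb.
have z0 z : homogeneous d z -> twcoef t z = 0.
  by move=> hz; apply/eqP; apply: NNPP => /negP/hz/eqP; rewrite (negbTE td).
rewrite !z0 //; have sh := homogeneous_subspace d.
by apply: subspace_sum => // x _; exact: (subspaceZ _ sh (bP x)).
Qed.

Variable m : nat.
Hypotheses (m_gt0 : (0 < m)%N)
           (untwisted : forall a, twist C (elt C (a *+ m)%MM) = 1%g).

(** The translates of the leading term of [h] are pairwise distinct, and the largest
    of them cannot cancel. *)
Lemma lattice_orbit_free d h : h <> 0 ->
  free_family (fun x : monomial d => twbasis c (lattice C m (exponents x)) * h).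
Proof.
move=> h0 a ah; suff: forall x, ~ (a x != 0).
  by move=> nx x; apply/eqP; apply: NNPP => /negP; exact: nx.
move=> x0 ax0; have [s1 hs1] := twisted_neq0 h0.
have [x] := seq_argmax (@exponents d)
  (etrans (mem_filter (fun x => a x != 0) x0 (enum (monomial d))) 
     (introT andP (conj ax0 (mem_enum _ x0)))).
rewrite mem_filter => /andP[ax _] xmax.
have [s sh smax] := seq_argmax (quo C m) (twcoef_supp hs1).
move: (congr1 (twcoef (lattice C m (exponents x) * s)%g) ah).
rewrite twcoef0 raddf_sum (bigD1 x) //= big1 ?addr0 => [|y yx].
  rewrite twcoefZ twcoef_latticeM; apply/eqP; rewrite !mulf_neq0 ?cocycle_neq0 //.
  by rewrite mcoeff_neq0.
rewrite twcoefZ; apply/eqP; rewrite mulf_eq0; apply/orP.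
case: (eqVneq (a y) 0) => [|ay]; [by left|right].
apply: NNPP => /negP/twcoef_latticeM_neq0[t e ht].
have := congr1 (quo C m) e; rewrite !quo_latticeM //.
have le_y : (exponents y <= exponents x)%O.
  by apply: xmax; rewrite mem_filter ay mem_enum.
have le_t := smax t (twcoef_supp ht).
apply/eqP; rewrite Order.POrderTheory.gt_eqF //; apply: ltmc_le_add => //.
rewrite Order.POrderTheory.lt_neqAle le_y andbT.
by rewrite (inj_eq (@exponents_inj _)).
Qed.

Variable R : graded_resolution C c.
Local Notation N := (cells R).
Local Notation D := (differential R).
Local Notation gd := (cell_deg (g := R)).
Local Notation sz := (cell_dim (g := R)).

Definition euler_poly : {poly int} := \sum_a (-1) ^+ sz a * 'X^(gd a).

Lemma conv_euler_poly q d :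
  conv euler_poly q d = \sum_a (-1) ^+ sz a * (if (gd a <= d)%N then (q (d - gd a)%N)%:Z else 0).
Proof.
pose Q := \poly_(i < d.+1) (q i)%:Z.
transitivity ((euler_poly * Q)`_d).
  rewrite coefM; apply: eq_bigr => j _; rewrite coef_poly ltnS leq_subr //.
rewrite mulr_suml coef_sum; apply: eq_bigr => a _.
have -> : (-1) ^+ sz a = ((-1) ^+ sz a)%:P :> {poly int}.
  by rewrite rmorphXn /= rmorphN1.
rewrite -mulrA coefCM coefXnM; congr (_ * _).
by rewrite ltnNge; case: leqP => // _; rewrite coef_poly ltnS leq_subr.
Qed.

Definition ffun_differential (z : {ffun 'I_N -> A}) : {ffun 'I_N -> A} :=
  [ffun a => \sum_b D a b * z b].

Lemma ffun_differential_linear : linear ffun_differential.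
Proof.
move=> a y z; apply/ffunP => i; rewrite !ffunE scaler_sumr -big_split /=.
by apply: eq_bigr => j _; rewrite !ffunE mulrDr scalerAr.
Qed.
HB.instance Definition _ := GRing.isLinear.Build k {ffun 'I_N -> A} {ffun 'I_N -> A} _
  ffun_differential ffun_differential_linear.

Lemma ffun_differentialE z : ffun_differential z = [ffun a => (D *m \col_a z a) a 0].
Proof. by apply/ffunP => a; rewrite !ffunE mxE; apply: eq_bigr => b _; rewrite mxE. Qed.

(** The Euler characteristic, in degree [d], of the complex with values in a graded
    module with homogeneous components [Q] of dimensions [q]. *)
Section Euler.
Variables (Q : nat -> A -> Prop) (q : nat -> nat) (d : nat).
Hypotheses (dimQ : forall e, has_dim (Q e) (q e))
  (QM : forall e e' f y, homogeneous e f -> Q e' y -> Q (e + e') (f * y)).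

Definition layer i (z : {ffun 'I_N -> A}) := forall a,
  if (sz a == i) && (gd a <= d)%N then Q (d - gd a) (z a) else z a = 0.

Hypothesis exactQ : forall i z, layer i z -> ffun_differential z = 0 ->
  exists2 z', layer i.+1 z' & z = ffun_differential z'.

Lemma layer_supp i z a b : layer i z -> D a b * z b != 0 ->
  [/\ sz b = i, sz b = (sz a).+1, (gd a <= gd b <= d)%N & homogeneous (gd b - gd a) (D a b)].
Proof.
move=> lz Dz; have Dab : D a b != 0 by apply: contraNneq Dz => ->; rewrite mul0r.
have [t tD] := twisted_neq0 (elimN eqP Dab).
have [e1 e2] := differential_degree tD.
have := lz b; case: ifP => [/andP[/eqP bi bd] _|_ z0]; last by rewrite z0 mulr0 eqxx in Dz.
split=> //; first by rewrite bd andbT -e1 leq_addl.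
by move=> s /differential_degree[<- _]; rewrite addnK.
Qed.

Lemma euler_relation : conv euler_poly q d = 0.
Proof.
rewrite conv_euler_poly.
pose qi i a := if (sz a == i) && (gd a <= d)%N then q (d - gd a)%N else 0%N.
have dimL i : has_dim (layer i) (\sum_a qi i a)%N.
  apply: (@has_dim_ffun _ _ _ (fun a y =>
    if (sz a == i) && (gd a <= d)%N then Q (d - gd a) y else y = 0)) => a.
  by rewrite /qi; case: ifP => _; [exact: dimQ|exact: has_dim0].
have L0 x : layer n.+1 x -> x = 0.
  move=> lx; apply/ffunP => a; have := lx a; rewrite ffunE.
  by rewrite (ltn_eqF (leq_ltn_trans (cell_dim_le a) (ltnSn n))).
have D0 x : layer 0 x -> ffun_differential x = 0.
  move=> lx; apply/ffunP => a; rewrite !ffunE big1 // => b _; apply/eqP.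
  by apply: NNPP => /negP/(layer_supp lx)[->].
have DL i x : layer i.+1 x -> layer i (ffun_differential x).
  move=> lx a; rewrite ffunE; case: ifP => [/andP[/eqP ai ad]|nai].
    apply: subspace_sum; first exact: has_dim_subspace (dimQ _).
    move=> b _; case: (eqVneq (D a b * x b) 0) => [->|].
      exact: subspace0 (has_dim_subspace (dimQ _)).
    case/(layer_supp lx) => bi _ /andP[ab bd] hD.
    have -> : (d - gd a = (gd b - gd a) + (d - gd b))%N by lia.
    by apply: QM => //; have := lx b; rewrite bi eqxx bd.
  rewrite big1 // => b _; apply/eqP; apply: NNPP => /negP/(layer_supp lx)[bi bS /andP[ab bd] _].
  by move: nai; rewrite (leq_trans ab bd) andbT -eqSS -bS bi eqxx.
have DD x : ffun_differential (ffun_differential x) = 0.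
  apply/ffunP => a; rewrite ffun_differentialE !ffunE.
  have -> : \col_a (ffun_differential x) a = D *m \col_a x a.
    by apply/colP => b; rewrite mxE ffun_differentialE ffunE.
  by rewrite mulmxA differential2 mul0mx mxE.
have := exact_complex_euler (D := ffun_differential) dimL L0 D0 DL DD exactQ.
rewrite (eq_bigr (fun i : 'I_n.+1 => \sum_a (-1) ^+ i * (qi i a)%:Z)) => [|i _]; last first.
  by rewrite (big_morph Posz PoszD (erefl _)) mulr_sumr.
rewrite exchange_big /= => h; rewrite -[RHS]h; apply: eq_bigr => a _.
have ai : (sz a < n.+1)%N by rewrite ltnS cell_dim_le.
rewrite (bigD1 (Ordinal ai)) //= [X in _ + X]big1 ?addr0 => [|i ia].
  by rewrite /qi eqxx /=; case: ifP.
rewrite /qi (_ : (sz a == i) = false) ?mulr0 //.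
by apply/eqP => e; case/eqP: ia; apply: val_inj.
Qed.

End Euler.

(** In degree 0 only the base cell contributes; in the other degrees the resolution
    is exact. *)
Lemma euler_algebra d : conv euler_poly (monomial_count n) d = (d == 0%N)%:Z.
Proof.
case: (posnP d) => [->|d0] /=.
  rewrite conv_euler_poly (bigD1 (base_cell R)) //= [X in _ + X]big1 ?addr0.
    have /eqP -> : gd (base_cell R) == 0%N by rewrite cell_deg_eq0.
    have /eqP -> : sz (base_cell R) == 0%N by rewrite cell_dim_eq0.
    by rewrite expr0 mul1r -(cum0 (monomial_count n)) cum_monomial_count addn0 binn.
  by move=> a; rewrite leqn0 cell_deg_eq0 => /negbTE ->; rewrite mulr0.
apply: euler_relation; first exact: dim_homogeneous.
  by move=> e e' f y; exact: homogeneousM.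
move=> i z lz Dz.
have cY : homog_chain (fun _ : 'I_1 => 0%N) d i (\col_a z a).
  move=> a b t; rewrite mxE addn0; have := lz a.
  case: ifP => [/andP[/eqP -> ad] h /h ->|_ ->]; last by rewrite twcoef0 eqxx.
  by rewrite subnK.
have [||Z cZ ZE] := chain_exact cY.
- by move/ffunP: Dz => Dz; apply/colP => a; have := Dz a; rewrite ffun_differentialE !ffunE => ->; rewrite mxE.
- by right.
exists [ffun a => Z a 0].
  move=> a; rewrite ffunE; case: ifP => [/andP[ai ad] t /cZ[]|nai].
    by rewrite addn0 => <- _; rewrite addnK.
  apply: twcoefP => t; rewrite twcoef0; apply/eqP; apply: NNPP => /negP/cZ[e1 e2].
  by move: nai; rewrite e2 eqxx /= -e1 addn0 leq_addl.
apply/ffunP => a; rewrite ffun_differentialE ffunE.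
have -> : \col_a [ffun a => Z a 0] a = Z by apply/colP => b; rewrite mxE ffunE.
by rewrite -ZE mxE.
Qed.

Section Principal.
Variables (g : A) (delta : nat).
Hypotheses (hg : homogeneous delta g) (g0 : g <> 0).

Definition rmul y : A := y * g.
Lemma rmul_linear : linear rmul.
Proof. by move=> a y z; rewrite /rmul mulrDl scalerAl. Qed.
HB.instance Definition _ := GRing.isLinear.Build k A A _ rmul rmul_linear.

(** The ideal generated by [g], graded so that [g] has degree 0. *)
Definition multiples d := image_of rmul (homogeneous d).
Definition annihilator d := kernel_in rmul (homogeneous d).

Lemma multiplesM e e' f y : homogeneous e f -> multiples e' y -> multiples (e + e') (f * y).
Proof.
move=> hf [x hx ->]; exists (f * x); first exact: homogeneousM.
by rewrite /= /rmul mulrA.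
Qed.

(** [eventually_exact] applies to the matrix with the single entry [g], whose row
    space is the ideal. *)
Lemma euler_multiples q : (forall d, has_dim (multiples d) (q d)) ->
  exists d0, forall d, (d0 <= d)%N -> conv euler_poly q d = 0.
Proof.
move=> dimq.
pose e (_ : 'I_1) := delta; pose e' (_ : 'I_1) := 0%N.
pose F : 'M[A]_1 := g%:M.
have FE : F 0 0 = g by rewrite mxE eqxx.
have gF : graded_matrix C e e' F.
  by move=> b l t; rewrite !ord1 FE addn0 => /hg.
have ex i := eventually_exact R m_gt0 untwisted i gF.
have [d0 d0P] := functional_choice _ ex.
exists (\max_(i < n.+1) d0 i)%N => d dd.
apply: (euler_relation dimq multiplesM) => i z lz Dz.
case: (ltnP n i) => [ni|ni].
  exists 0; last first.
    rewrite linear0; apply/ffunP => a; have := lz a; rewrite ffunE.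
    by rewrite (ltn_eqF (leq_ltn_trans (cell_dim_le a) ni)).
  move=> a; rewrite ffunE; case: ifP => // _.
  exact: subspace0 (has_dim_subspace (dimq _)).
have [x xP] : exists x : 'I_N -> A, forall a, z a = x a * g /\
    if (sz a == i) && (gd a <= d)%N then homogeneous (d - gd a) (x a) else x a = 0.
  apply: (functional_choice (fun a x => z a = x * g /\
    if (sz a == i) && (gd a <= d)%N then homogeneous (d - gd a) x else x = 0)) => a.
  have := lz a; case: ifP => _ [].
    by move=> x hx ->; exists x.
  by exists 0; rewrite mul0r.
have colMF (u : 'cV[A]_N) a : (u *m F) a 0 = u a 0 * g.
  by rewrite mxE big_ord1 FE.
have zE : \col_a z a = (\col_a x a) *m F.
  by apply/colP => a; rewrite colMF !mxE; case: (xP a).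
have cY : homog_chain e (d + delta) i (\col_a x a).
  move=> a b t; rewrite mxE /e; have [_] := xP a.
  case: ifP => [/andP[/eqP -> ad] h /h ->|_ ->]; last by rewrite twcoef0 eqxx.
  by rewrite subnK.
have [||Z cZ ZE] := d0P i (d + delta)%N _ _ cY.
- apply: leq_trans (leq_addr _ _); apply: leq_trans dd.
  exact: (leq_bigmax (Ordinal (ni : (i < n.+1)%N))).
- rewrite -zE; move/ffunP: Dz => Dz; apply/colP => a.
  by have := Dz a; rewrite ffun_differentialE !ffunE => ->; rewrite mxE.
exists [ffun a => Z a 0 * g].
  move=> a; rewrite ffunE; case: ifP => [/andP[ai ad]|nai].
    exists (Z a 0) => // t /cZ[]; rewrite /e => h _; lia.
  rewrite (_ : Z a 0 = 0) ?mul0r //.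
  apply: twcoefP => t; rewrite twcoef0; apply/eqP; apply: NNPP => /negP/cZ[e1 e2].
  by move: nai; rewrite e2 eqxx /=; move: e1; rewrite /e; lia.
have ZF : \col_a [ffun a => Z a 0 * g] a = Z *m F.
  by apply/colP => a; rewrite colMF mxE ffunE.
by apply/ffunP => a; rewrite ffun_differentialE ffunE ZF mulmxA -ZE -zE mxE.
Qed.

(** The multiplicities [(1 - p).[1]] of the annihilator and [p.[1]] of the multiples
    of [g] are integers with sum 1, so one of them is at most 0; but both
    ideals contain free orbits of the lattice. *)
Lemma homogeneous_regular f phi : homogeneous phi f -> f * g = 0 -> f = 0.
Proof.
move=> hf fg; apply: NNPP => f0.
have /functional_choice[r rP] : forall d, exists r : nat * nat,
  [/\ has_dim (annihilator d) r.1, has_dim (multiples d) r.2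
    & monomial_count n d = (r.1 + r.2)%N].
  move=> d; have [r1 [r2 h]] := rank_nullity rmul (dim_homogeneous d).
  by exists (r1, r2).
pose f1 d := (r d).1; pose f2 d := (r d).2.
have dimf2 d : has_dim (multiples d) (f2 d) by case: (rP d).
have [d0 ed0] := euler_multiples dimf2.
have [p pP] := conv_inverse euler_algebra ed0.
have f1E d : (f1 d)%:Z = conv (1 - p) (monomial_count n) d.
  have [_ _ e] := rP d; have := pP d; rewrite /conv => e2.
  under eq_bigr do rewrite coefB mulrBl.
  rewrite sumrB -e2 big_ord_recl /= coef1 mul1r subn0 big1 ?addr0 => [|j _].
    by rewrite e PoszD /f1 /f2 addrK.
  by rewrite coef1 mul0r.
have grow1 d : (monomial_count n d <= f1 (phi + d * m))%N.
  have [h1 _ _] := rP (phi + d * m)%N.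
  rewrite -card_monomial; apply: (free_family_card h1 (lattice_orbit_free f0)) => x.
  split; last by rewrite /= /rmul -mulrA fg mulr0.
  rewrite addnC; apply: homogeneousM hf => t; rewrite twcoef_basis.
  case: (lattice C m _ =P t) => [<- _|]; last by rewrite eqxx.
  by rewrite weight_lattice mdeg_exponents.
have grow2 d : (monomial_count n d <= f2 (0 + d * m))%N.
  have [_ h2 _] := rP (0 + d * m)%N.
  rewrite -card_monomial; apply: (free_family_card h2 (lattice_orbit_free g0)) => x.
  exists (twbasis c (lattice C m (exponents x))) => // t; rewrite twcoef_basis.
  case: (lattice C m _ =P t) => [<- _|]; last by rewrite eqxx.
  by rewrite weight_lattice mdeg_exponents.
case: (lerP p.[1] 0) => p1.
  exact: (hilbert_growth_contradiction m_gt0 p1 pP grow2).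
have q1 : (1 - p).[1] <= 0.
  by rewrite hornerD hornerN hornerC subr_le0 -gtz0_ge1.
exact: (hilbert_growth_contradiction m_gt0 q1 f1E grow1).
Qed.

End Principal.

End Domain.

(** * The domain property *)

Section TopDegree.
Variables (k : fieldType) (S : monoidType) (n : nat) (C : coordinates S n).
Variable c : cocycle k S.
Local Notation A := (twisted c).

Lemma top_part (f : A) : f <> 0 -> exists d f1 f2,
  [/\ f = f1 + f2, homogeneous C d f1, f1 <> 0 &
      forall t, twcoef t f2 != 0 -> (weight C t < d)%N].
Proof.
case/twisted_neq0 => s0 fs0.
have [s fs smax] := seq_argmax (weight C) (twcoef_supp fs0).
exists (weight C s), (restrict (fun t => weight C t == weight C s) f).
exists (f - restrict (fun t => weight C t == weight C s) f).
split; first by rewrite addrC subrK.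
- move=> t; rewrite twcoef_restrict.
  by case: (weight C t =P _) => // _; rewrite eqxx.
- move/(congr1 (twcoef s)); rewrite twcoef_restrict eqxx twcoef0 => /eqP.
  by apply/negP; rewrite mcoeff_neq0.
move=> t; rewrite twcoefB twcoef_restrict.
case: (weight C t =P _) => [_|/eqP ts]; first by rewrite subrr eqxx.
by rewrite subr0 => /twcoef_supp/smax; rewrite leEnat ltn_neqAle ts.
Qed.

Lemma twisted_domain : is_domain A.
Proof.
have [m m0 tw] := untwisted_multiples C.
move=> f g fg; apply: NNPP => nfg.
have f0 : f <> 0 by move=> f0; apply: nfg; left.
have g0 : g <> 0 by move=> g0; apply: nfg; right.
have [d1 [f1 [f2 [fE hf1 f10 f2d]]]] := top_part f0.
have [d2 [g1 [g2 [gE hg1 g10 g2d]]]] := top_part g0.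
apply: f10; apply: (homogeneous_regular m0 tw (flag_resolution C c) hg1 g10 hf1).
apply: twcoefP => t; rewrite twcoef0; apply/eqP; apply: NNPP => /negP h.
have td := homogeneousM hf1 hg1 h; case/negP: h.
have -> : f1 * g1 = f * g - f1 * g2 - f2 * g.
  by rewrite fE mulrDl addrAC addrK {1}gE mulrDr addrK.
have z (x y : A) : (forall s u, twcoef s x != 0 -> twcoef u y != 0 ->
    (weight C s + weight C u < d1 + d2)%N) -> twcoef t (x * y) = 0.
  move=> xy; apply/eqP; apply: NNPP => /negP/twcoef_mul_neq0[s [u [e xs yu]]].
  by have := xy s u xs yu; rewrite -weightM -e td ltnn.
rewrite !twcoefB fg twcoef0 !z ?subr0 // => s u.
  move=> /f2d sd; rewrite gE twcoefD; case: (eqVneq (twcoef u g1) 0) => [->|/hg1 -> _].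
    by rewrite add0r => /g2d ud; rewrite -addSn leq_add // ltnW.
  by rewrite ltn_add2r.
by move=> /hf1 -> /g2d; rewrite ltn_add2l.
Qed.

End TopDegree.

Theorem corollary1p6 (k : fieldType) (S : monoidType) (hS : I_type S) :
  (forall c : cocycle k S, is_domain (twisted c)) /\ cancellative S.
Proof.
have [n [C]] := I_type_coordinates hS.
by split=> [c|]; [exact: twisted_domain C c|exact: coordinates_cancellative C].
Qed.
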